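(* Let $G$ be a finite group, $N\trianglelefteq G$, $\bar G=G/N$, $Q$ a Sylow $p$-subgroup of $G$, $G'=N_G(Q)$ and $N'=G'\cap N$. Let $b\in Z(\mathcal{O}N)$ and $b'\in Z(\mathcal{O}N')$ be the principal block idempotents, $A=b\mathcal{O}G$, $A'=b'\mathcal{O}G'$, $B=b\mathcal{O}N$, $B'=b'\mathcal{O}N'$, and let $K=\{(g,g')\in G\times G'\mid\bar g=\bar g'\text{ in }\bar G=G/N\simeq G'/N'\}$. Assume that $p$ does not divide the order of $\bar G$, and denote $M=\mathrm{Sc}(N\times N',\Delta Q)$. Then $$M\simeq\mathrm{Res}^K_{N\times N'}\mathrm{Sc}(K,\Delta Q).$$ In particular, $M$ may be regarded as a $\Delta(A\otimes_{\mathcal{O}}A'^{\mathrm{op}})$-module, and moreover, $M$ may be chosen such that $\tilde M:=A\otimes_BM$ is a $\bar G$-graded $(A,A')$-bimodule over $\mathcal{C}=\mathcal{O}C_G(N)$.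
   Context: $(\mathcal{K},\mathcal{O},k)$ is a $p$-modular system: $\mathcal{O}$ is a complete discrete valuation ring with field of fractions $\mathcal{K}$ and algebraically closed residue field $k$ of characteristic $p$; $\mathcal{K}$ contains all roots of unity of order $|G|$. $\Delta Q=\{(q,q)\mid q\in Q\}$. For a finite group $H$ and a subgroup $P\le H$, the Scott module $\mathrm{Sc}(H,P)$ is the unique (up to isomorphism) indecomposable direct summand of $\mathrm{Ind}_P^H(\mathcal{O})$ having the trivial module $\mathcal{O}_H$ as a quotient. $\mathcal{O}(N\times N')$-modules are regarded as $(\mathcal{O}N,\mathcal{O}N')$-bimodules via $(n,n')m=nmn'^{-1}$. In this situation $G=NG'$ and $C_G(N)\subseteq G'$. $A$ and $A'$ are $\bar G$-graded with $A_{\bar g}=b\mathcal{O}[gN]$ and $A'_{\bar g}=b'\mathcal{O}[gN']$ ($g\in G'$). $\Delta(A\otimes_{\mathcal{O}}A'^{\mathrm{op}})=\bigoplus_{\bar g\in\bar G}A_{\bar g}\otimes_{\mathcal{O}}A'_{\bar g^{-1}}$ is the $\mathcal{O}$-algebra with $(a\otimes a')(d\otimes d')=ad\otimes d'a'$ (products on the right in $A$ and $A'$); an $\mathcal{O}K$-module whose restriction to $N\times N'$ is a $(B,B')$-bimodule is a module over it via $(g\otimes g'^{-1})m=(g,g')m$. For a $\Delta(A\otimes_{\mathcal{O}}A'^{\mathrm{op}})$-module $M$, $A\otimes_BM$ is a $\bar G$-graded $(A,A')$-bimodule with $\bar x$-component $A_{\bar x}\otimes_BM$, and right action $(a\otimes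 m)a'=au\otimes(u^{-1}\otimes a')m$ for $a'\in A'_{\bar h}$ and $u$ any invertible element of $A$ lying in $A_{\bar h}$. A $\bar G$-graded $(A,A')$-bimodule $\tilde M$ (i.e. $A_{\bar g}\tilde M_{\bar x}A'_{\bar h}\subseteq\tilde M_{\bar g\bar x\bar h}$) is over $\mathcal{C}=\mathcal{O}C_G(N)$ if $\tilde m_{\bar g}\,c=(gcg^{-1})\,\tilde m_{\bar g}$ for all $c\in C_G(N)$, $g\in G$, $\tilde m_{\bar g}\in\tilde M_{\bar g}$. *)

(* Defs.v *)
From HB Require Import structures.
From mathcomp Require Import all_boot all_order all_algebra all_fingroup.
From mathcomp Require Import all_solvable fraction.
From mathcomp Require Import boolp.

Set Implicit Arguments.
Unset Strict Implicit.
Unset Printing Implicit Defensive.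

Import GRing.Theory.
Local Open Scope ring_scope.

Section ModularSystem.
Variable O : idomainType.

(* The normalised discrete valuation is x = u * pi ^+ n |-> n; since pi is not
   a unit, O is not a field. *)
Definition uniformizer (pi : O) : Prop :=
  [/\ pi != 0, pi \isn't a GRing.unit
    & forall x, x != 0 ->
        exists (n : nat) (u : O), u \is a GRing.unit /\ x = u * pi ^+ n].

Definition pow_dvd (pi : O) (n : nat) (x : O) : Prop :=
  exists y, x = pi ^+ n * y.

Definition adic_cauchy (pi : O) (a : nat -> O) : Prop :=
  forall n, exists m0, forall i j, (m0 <= i)%N -> (m0 <= j)%N ->
    pow_dvd pi n (a i - a j).

Definition adic_limit (pi : O) (a : nat -> O) (l : O) : Prop :=
  forall n, exists m0, forall i, (m0 <= i)%N -> pow_dvd pi n (a i - l).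

Definition complete_dvr : Prop :=
  exists pi, uniformizer pi /\
    forall a, adic_cauchy pi a -> exists l, adic_limit pi a l.

(* The field of fractions is {fraction O}; the residue field is presented by
   the surjection [red], whose kernel is the ideal of non-units. *)
Definition modular_system (p : nat) (k : closedFieldType)
    (red : {rmorphism O -> k}) (n : nat) : Prop :=
  [/\ complete_dvr,
      (forall y, exists x, red x = y)
        /\ (forall x, red x = 0 <-> x \isn't a GRing.unit),
      p \in [pchar k]
    & exists z : {fraction O}, n.-primitive_root z].

End ModularSystem.

Definition galg (O : comNzRingType) (X : finGroupType) := {ffun X -> O}.

Section GroupAlgebra.
Variables (O : comNzRingType) (X : finGroupType).
Local Notation R := (galg O X).

HB.instance Definition _ := GRing.Lmodule.copy R {ffun X -> O^o}.

Definition gelt (g : X) : R := [ffun h => (h == g)%:R].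

Definition gmul (x y : R) : R := [ffun g => \sum_h x h * y (h^-1 * g)%g].

Lemma gmulE x y g : gmul x y g = \sum_h x h * y (h^-1 * g)%g.
Proof. by rewrite ffunE. Qed.

Lemma gmul_eltl h y g : gmul (gelt h) y g = y (h^-1 * g)%g.
Proof.
rewrite gmulE (bigD1 h) //= big1 => [|i /negPf ni]; rewrite ffunE ?ni ?mul0r //.
by rewrite eqxx mul1r addr0.
Qed.

Lemma gmulA : associative gmul.
Proof.
move=> x y z; apply/ffunP => g; rewrite !gmulE.
under eq_bigr => h _ do rewrite gmulE mulr_sumr.
under [RHS]eq_bigr => h _ do rewrite gmulE mulr_suml.
rewrite [RHS]exchange_big /=; apply: eq_bigr => h _.
rewrite [RHS](reindex_inj (mulgI h)) /=; apply: eq_bigr => i _.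
by rewrite mulrA mulKg invMg mulgA.
Qed.

Lemma gmul1l : left_id (gelt 1) gmul.
Proof. by move=> x; apply/ffunP => g; rewrite gmul_eltl invg1 mul1g. Qed.

Lemma gmul1r : right_id (gelt 1) gmul.
Proof.
move=> x; apply/ffunP => g; rewrite gmulE (bigD1 g) //= big1 => [|i ni].
  by rewrite mulVg ffunE eqxx mulr1 addr0.
by rewrite ffunE -(inj_eq (mulgI i)) mulKVg mulg1 eq_sym (negPf ni) mulr0.
Qed.

Lemma gmulDl : left_distributive gmul +%R.
Proof.
move=> x y z; apply/ffunP => g; rewrite [RHS]ffunE !gmulE -big_split /=.
by apply: eq_bigr => h _; rewrite ffunE mulrDl.
Qed.

Lemma gmulDr : right_distributive gmul +%R.
Proof.
move=> x y z; apply/ffunP => g; rewrite [RHS]ffunE !gmulE -big_split /=.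
by apply: eq_bigr => h _; rewrite ffunE mulrDr.
Qed.

Lemma gelt1_neq0 : gelt 1 != 0.
Proof.
by apply/eqP => /ffunP/(_ 1%g); rewrite !ffunE eqxx; apply/eqP/oner_neq0.
Qed.

HB.instance Definition _ := GRing.Zmodule_isNzRing.Build R
  gmulA gmul1l gmul1r gmulDl gmulDr gelt1_neq0.

Lemma galgME (x y : R) g : (x * y) g = \sum_h x h * y (h^-1 * g)%g.
Proof. exact: gmulE. Qed.

Lemma gscaleAl (a : O) (x y : R) : a *: (x * y) = (a *: x) * y.
Proof.
apply/ffunP => g; rewrite [LHS]ffunE !galgME [LHS]mulr_sumr.
by apply: eq_bigr => h _; rewrite [in RHS]ffunE mulrA.
Qed.

HB.instance Definition _ := GRing.Lmodule_isLalgebra.Build O R gscaleAl.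

Lemma gscaleAr (a : O) (x y : R) : a *: (x * y) = x * (a *: y).
Proof.
apply/ffunP => g; rewrite [LHS]ffunE !galgME [LHS]mulr_sumr.
by apply: eq_bigr => h _; rewrite [in RHS]ffunE mulrCA.
Qed.

HB.instance Definition _ := GRing.Lalgebra_isAlgebra.Build O R gscaleAr.

Lemma geltM g h : gelt g * gelt h = gelt (g * h).
Proof.
apply/ffunP => i; rewrite gmul_eltl !ffunE.
by rewrite -(inj_eq (mulgI g)) mulKVg.
Qed.

(* O[S] as a subset of the group algebra of the ambient group *)
Definition supported (S : {set X}) (x : R) : Prop :=
  forall g, g \notin S -> x g = 0.

Lemma supportedM (H : {group X}) x y :
  supported H x -> supported H y -> supported H (x * y).
Proof.
move=> Hx Hy g Hg; rewrite galgME big1 // => h _.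
have [hH|/Hx->] := boolP (h \in H); last by rewrite mul0r.
by rewrite Hy ?mulr0 // groupMl ?groupV.
Qed.

Definition aug (x : R) : O := \sum_g x g.

Lemma aug1 : aug 1 = 1.
Proof.
rewrite /aug (bigD1 1%g) //= big1 => [|g /negPf ng]; rewrite ffunE ?ng //.
by rewrite eqxx addr0.
Qed.

Lemma augM x y : aug (x * y) = aug x * aug y.
Proof.
rewrite /aug; under eq_bigr => g _ do rewrite galgME.
rewrite exchange_big mulr_suml; apply: eq_bigr => h _ /=.
rewrite (reindex_inj (mulgI h)) mulr_sumr /=.
by apply: eq_bigr => g _; rewrite mulKg.
Qed.

Lemma augD x y : aug (x + y) = aug x + aug y.
Proof. by rewrite /aug -big_split; apply: eq_bigr => g _; rewrite ffunE. Qed.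

Lemma augZ c x : aug (c *: x) = c * aug x.
Proof. by rewrite /aug mulr_sumr; apply: eq_bigr => g _; rewrite ffunE. Qed.

(* Block idempotents are the primitive idempotents of Z(OH); the principal one
   is the one not annihilating the trivial module. *)
Definition central_idem (H : {set X}) (e : R) : Prop :=
  [/\ supported H e, forall x, supported H x -> e * x = x * e & e * e = e].

Definition block_idem (H : {set X}) (e : R) : Prop :=
  [/\ central_idem H e, e != 0
    & forall f, central_idem H f -> f * e = f -> f = 0 \/ f = e].

Definition principal_block (H : {set X}) (e : R) : Prop :=
  block_idem H e /\ aug e != 0.

End GroupAlgebra.

(* All algebras below are O-submodules of a group algebra, closed under
   multiplication but possibly with an identity element other than 1, such as
   b * OG with identity b.  They are given by their elements and identity. *)
Record subalg (O : comNzRingType) (R : algType O) :=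
  Subalg { in_subalg :> R -> Prop; sub_one : R }.

(* The values of [act] outside E are irrelevant. *)
Record mod_axioms (O : comNzRingType) (R : algType O) (E : subalg R)
    (V : lmodType O) (act : R -> V -> V) : Prop := ModAxioms {
  actDr : forall a, E a -> forall v w, act a (v + w) = act a v + act a w;
  actZr : forall a, E a -> forall (c : O) v, act a (c *: v) = c *: act a v;
  actDl : forall a d, E a -> E d -> forall v,
            act (a + d) v = act a v + act d v;
  actZl : forall (c : O) a, E a -> forall v, act (c *: a) v = c *: act a v;
  actM : forall a d, E a -> E d -> forall v, act (a * d) v = act a (act d v);
  act1 : forall v, act (sub_one E) v = v }.

Record module (O : comNzRingType) (R : algType O) (E : subalg R) := Module {
  mcar :> lmodType O;
  mod_act : R -> mcar -> mcar;
  mod_actP : mod_axioms E mod_act }.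

Section Modules.
Variables (O : comNzRingType) (R : algType O) (E : subalg R).

Definition mod_hom (V W : module E) (f : V -> W) : Prop :=
  [/\ forall v w, f (v + w) = f v + f w,
      forall (c : O) v, f (c *: v) = c *: f v
    & forall a, E a -> forall v, f (mod_act a v) = mod_act a (f v)].

Definition mod_iso (V W : module E) (f : V -> W) : Prop :=
  mod_hom f /\ bijective f.

Definition isomorphic (V W : module E) : Prop := exists f : V -> W, mod_iso f.

Definition dsum_act (V W : module E) (a : R) (v : V * W) : V * W :=
  (mod_act a v.1, mod_act a v.2).

Lemma dsum_axioms (V W : module E) : mod_axioms E (@dsum_act V W).
Proof.
have [VD VZ DV ZV MV V1] := mod_actP V; have [WD WZ DW ZW MW W1] := mod_actP W.
split.
- by move=> a Ea [v1 w1] [v2 w2]; rewrite /dsum_act /= VD ?WD.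
- by move=> a Ea c [v w]; rewrite /dsum_act /= VZ ?WZ.
- by move=> a d Ea Ed [v w]; rewrite /dsum_act /= DV ?DW.
- by move=> c a Ea [v w]; rewrite /dsum_act /= ZV ?ZW.
- by move=> a d Ea Ed [v w]; rewrite /dsum_act /= MV ?MW.
- by move=> [v w]; rewrite /dsum_act /= V1 W1.
Qed.

Definition dsum (V W : module E) : module E := Module (dsum_axioms V W).

Definition summand (V X : module E) : Prop :=
  exists W : module E, isomorphic (dsum V W) X.

Definition indecomposable (V : module E) : Prop :=
  (exists v : V, v != 0) /\
  forall U W : module E, isomorphic V (dsum U W) ->
    (forall u : U, u = 0) \/ (forall w : W, w = 0).

End Modules.

(* A and B are subsets of R, V is a left B-module.  The elements of [tensor]
   are formal sums of pairs (a, v), in which pairs with a outside A are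
   discarded, modulo the relation of being identified by every B-balanced map
   on A * V.  See [tensor_balanced] and [tensor_univ]. *)
Section Tensor.
Variables (O : comNzRingType) (R : algType O) (A B : R -> Prop).
Variables (V : lmodType O) (act : R -> V -> V).

Record balanced (W : lmodType O) (f : R -> V -> W) : Prop := Balanced {
  balDl : forall a d, A a -> A d -> forall v, f (a + d) v = f a v + f d v;
  balDr : forall a, A a -> forall v w, f a (v + w) = f a v + f a w;
  balZl : forall (c : O) a, A a -> forall v, f (c *: a) v = c *: f a v;
  balZr : forall a, A a -> forall (c : O) v, f a (c *: v) = c *: f a v;
  balM : forall a r, A a -> B r -> forall v, f (a * r) v = f a (act r v) }.

Definition feval (W : lmodType O) (f : R -> V -> W) (s : seq (R * V)) : W :=
  \sum_(x <- s | `[< A x.1 >]) f x.1 x.2.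

Definition tensor_eqv (s t : seq (R * V)) : bool :=
  `[< forall (W : lmodType O) (f : R -> V -> W),
        balanced f -> feval f s = feval f t >].

Lemma tensor_eqvP s t :
  reflect (forall (W : lmodType O) (f : R -> V -> W),
             balanced f -> feval f s = feval f t) (tensor_eqv s t).
Proof. exact: asboolP. Qed.

Lemma tensor_eqv_refl : reflexive tensor_eqv.
Proof. by move=> s; apply/tensor_eqvP. Qed.

Lemma tensor_eqv_sym : symmetric tensor_eqv.
Proof.
by move=> s t; apply/tensor_eqvP/tensor_eqvP => st W f bf; rewrite st.
Qed.

Lemma tensor_eqv_trans : transitive tensor_eqv.
Proof.
move=> t s u /tensor_eqvP st /tensor_eqvP tu.
by apply/tensor_eqvP => W f bf; rewrite st ?tu.
Qed.

Canonical tensor_equiv :=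
  EquivRel tensor_eqv tensor_eqv_refl tensor_eqv_sym tensor_eqv_trans.

Local Notation qrepr := generic_quotient.repr.

Definition tensor := {eq_quot tensor_equiv}%qT.
HB.instance Definition _ := Choice.on tensor.
HB.instance Definition _ : EqQuotient _ tensor_equiv tensor :=
  EqQuotient.on tensor.

Definition tcls (s : seq (R * V)) : tensor := (\pi_tensor s)%qT.

Lemma tclsP s t : (forall (W : lmodType O) (f : R -> V -> W),
  balanced f -> feval f s = feval f t) -> tcls s = tcls t.
Proof. by move=> st; apply/eqmodP/tensor_eqvP. Qed.

Definition tlift (W : lmodType O) (f : R -> V -> W) (t : tensor) : W :=
  feval f (qrepr t).

Lemma tlift_cls W f s : balanced f -> @tlift W f (tcls s) = feval f s.
Proof.
move=> bf; rewrite /tlift.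
have /eqmodP/tensor_eqvP -> // : (qrepr (tcls s) = s %[mod tensor])%qT.
by rewrite reprK.
Qed.

Lemma tclsK t : tcls (qrepr t) = t.
Proof. exact: reprK. Qed.

Definition tzero := tcls [::].
Definition tadd (s t : tensor) := tcls (qrepr s ++ qrepr t).
Definition tscale (c : O) (t : tensor) :=
  tcls [seq (x.1, c *: x.2) | x <- qrepr t].
Definition topp (t : tensor) := tscale (-1) t.

Lemma feval_cat (W : lmodType O) (f : R -> V -> W) s t :
  feval f (s ++ t) = feval f s + feval f t.
Proof. exact: big_cat. Qed.

Lemma feval_scale (W : lmodType O) (f : R -> V -> W) c s : balanced f ->
  feval f [seq (x.1, c *: x.2) | x <- s] = c *: feval f s.
Proof.
move=> bf; rewrite /feval big_map scaler_sumr.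
by apply: eq_bigr => x /asboolP Ax /=; rewrite (balZr bf).
Qed.

Lemma feval_repr (W : lmodType O) (f : R -> V -> W) s : balanced f ->
  feval f (qrepr (tcls s)) = feval f s.
Proof. exact: tlift_cls. Qed.

Lemma taddE s t : tadd (tcls s) (tcls t) = tcls (s ++ t).
Proof. by apply: tclsP => W f bf; rewrite !feval_cat !feval_repr. Qed.

Lemma tscaleE c s : tscale c (tcls s) = tcls [seq (x.1, c *: x.2) | x <- s].
Proof. by apply: tclsP => W f bf; rewrite !feval_scale // feval_repr. Qed.

Lemma taddA : associative tadd.
Proof.
move=> s t u; rewrite -[s]tclsK -[t]tclsK -[u]tclsK !taddE.
by rewrite catA.
Qed.

Lemma taddC : commutative tadd.
Proof. by move=> s t; apply: tclsP => W f bf; rewrite !feval_cat addrC. Qed.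

Lemma tadd0 : left_id tzero tadd.
Proof. by move=> s; rewrite -[s]tclsK taddE. Qed.

Lemma taddN : left_inverse tzero topp tadd.
Proof.
move=> s; rewrite -[s]tclsK /topp tscaleE taddE.
apply: tclsP => W f bf; rewrite feval_cat feval_scale // scaleN1r addNr.
by rewrite /feval big_nil.
Qed.

HB.instance Definition _ :=
  GRing.isZmodule.Build tensor taddA taddC tadd0 taddN.

Lemma tscaleA c d t : tscale c (tscale d t) = tscale (c * d) t.
Proof.
rewrite -[t]tclsK !tscaleE; apply: tclsP => W f bf.
by rewrite !feval_scale // scalerA.
Qed.

Lemma tscale1 : left_id 1 tscale.
Proof.
move=> t; rewrite -[t]tclsK tscaleE; apply: tclsP => W f bf.
by rewrite feval_scale // scale1r.
Qed.

Lemma tscaleDr : right_distributive tscale +%R.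
Proof.
move=> c s t; rewrite -[s]tclsK -[t]tclsK [_ + _]taddE !tscaleE [RHS]taddE.
by rewrite map_cat.
Qed.

Lemma tscaleDl t : {morph tscale^~ t : c d / c + d}.
Proof.
move=> c d; rewrite -[t]tclsK !tscaleE [RHS]taddE.
by apply: tclsP => W f bf; rewrite feval_cat !feval_scale // scalerDl.
Qed.

HB.instance Definition _ := GRing.Zmodule_isLmodule.Build O tensor
  tscaleA tscale1 tscaleDr tscaleDl.

(* the pure tensor a (x) v, for a in A *)
Definition tpure (a : R) (v : V) : tensor := tcls [:: (a, v)].

Lemma feval_pure (W : lmodType O) (f : R -> V -> W) a v : A a ->
  feval f [:: (a, v)] = f a v.
Proof. by move=> Aa; rewrite /feval big_cons big_nil asboolT //= addr0. Qed.

Lemma tcls_sum s : tcls s = \sum_(x <- s | `[< A x.1 >]) tpure x.1 x.2.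
Proof.
elim: s => [|[a v] s IHs]; first by rewrite big_nil.
rewrite big_cons -IHs; case: asboolP => Aa; first exact/esym/taddE.
apply: tclsP => W f bf; rewrite -cat1s feval_cat.
by rewrite {1}/feval big_cons big_nil asboolF //= add0r.
Qed.

Lemma tensor_sum t :
  t = \sum_(x <- qrepr t | `[< A x.1 >]) tpure x.1 x.2.
Proof. by rewrite -tcls_sum tclsK. Qed.

Lemma tensor_balanced :
  (forall a d, A a -> A d -> A (a + d)) ->
  (forall (c : O) a, A a -> A (c *: a)) ->
  (forall a r, A a -> B r -> A (a * r)) ->
  balanced tpure.
Proof.
move=> AD AZ AM; split.
- move=> a d Aa Ad v; rewrite [RHS]taddE; apply: tclsP => W f bf.
  by rewrite feval_cat !feval_pure ?(balDl bf) //; apply: AD.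
- move=> a Aa v w; rewrite [RHS]taddE; apply: tclsP => W f bf.
  by rewrite feval_cat !feval_pure ?(balDr bf).
- move=> c a Aa v; rewrite [RHS]tscaleE; apply: tclsP => W f bf.
  by rewrite !feval_pure ?(balZl bf) ?(balZr bf) //; apply: AZ.
- move=> a Aa c v; rewrite [RHS]tscaleE; apply: tclsP => W f bf.
  by rewrite !feval_pure.
- move=> a r Aa Br v; apply: tclsP => W f bf.
  by rewrite !feval_pure ?(balM bf) //; apply: AM.
Qed.

Lemma tliftD (W : lmodType O) (f : R -> V -> W) s t : balanced f ->
  tlift f (s + t) = tlift f s + tlift f t.
Proof.
move=> bf; rewrite -[s]tclsK -[t]tclsK [_ + _]taddE.
by rewrite !tlift_cls // feval_cat.
Qed.

Lemma tliftZ (W : lmodType O) (f : R -> V -> W) c t : balanced f ->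
  tlift f (c *: t) = c *: tlift f t.
Proof.
move=> bf; rewrite -[t]tclsK [_ *: _]tscaleE.
by rewrite !tlift_cls // feval_scale.
Qed.

Lemma tensor_univ (W : lmodType O) (f : R -> V -> W) : balanced f ->
  exists! h : tensor -> W,
    [/\ forall s t, h (s + t) = h s + h t,
        forall (c : O) t, h (c *: t) = c *: h t
      & forall a v, A a -> h (tpure a v) = f a v].
Proof.
move=> bf; exists (tlift f); split.
  split=> [s t|c t|a v Aa]; rewrite ?tliftD ?tliftZ //.
  by rewrite tlift_cls // feval_pure.
move=> h [hD hZ hp]; apply/funext => t; rewrite (tensor_sum t).
have h0 : h 0 = 0 by rewrite -(scale0r 0) hZ scale0r.
have t0 : tlift f 0 = 0 by rewrite -(scale0r 0) tliftZ // scale0r.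
pose P s := tlift f s = h s; rewrite -/(P _); apply: big_ind.
- by rewrite /P h0 t0.
- by move=> s u Ps Pu; rewrite /P hD tliftD // Ps Pu.
- by move=> x /asboolP Ax; rewrite /P hp // tlift_cls // feval_pure.
Qed.

Definition tact (d : R) (t : tensor) : tensor :=
  \sum_(x <- qrepr t | `[< A x.1 >]) tpure (d * x.1) x.2.

Section LeftAction.
Variable E : subalg R.
Hypotheses (AD : forall a d, A a -> A d -> A (a + d))
  (AZ : forall (c : O) a, A a -> A (c *: a))
  (AM : forall a r, A a -> B r -> A (a * r))
  (EA : forall d a, E d -> A a -> A (d * a))
  (E1 : forall a, A a -> sub_one E * a = a).

Let tp := tensor_balanced AD AZ AM.

Lemma tact_balanced d : E d -> balanced (fun a v => tpure (d * a) v).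
Proof.
move=> Ed; split=> [a e Aa Ae v|a Aa v w|c a Aa v|a Aa c v|a r Aa Br v].
- by rewrite mulrDr (balDl tp) //; apply: EA.
- by rewrite (balDr tp) //; apply: EA.
- by rewrite -scalerAr (balZl tp) //; apply: EA.
- by rewrite (balZr tp) //; apply: EA.
- by rewrite mulrA (balM tp) //; apply: EA.
Qed.

Lemma tactE d : tact d = tlift (fun a v => tpure (d * a) v).
Proof. by []. Qed.

Lemma tact_pure d a v : E d -> A a -> tact d (tpure a v) = tpure (d * a) v.
Proof.
by move=> Ed Aa; rewrite tactE tlift_cls ?feval_pure //; apply: tact_balanced.
Qed.

Lemma tensor_ind (P : tensor -> Prop) :
  P 0 -> (forall s t, P s -> P t -> P (s + t)) ->
  (forall a v, A a -> P (tpure a v)) -> forall t, P t.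
Proof.
by move=> P0 PD Pp t; rewrite (tensor_sum t); apply: big_ind => // x /asboolP/Pp.
Qed.

Lemma tact0 d : E d -> tact d 0 = 0.
Proof.
move=> Ed; rewrite -(scale0r 0) tactE tliftZ ?scale0r //.
exact: tact_balanced.
Qed.

Lemma tact_axioms : (forall a d, E a -> E d -> E (a + d)) ->
    (forall (c : O) a, E a -> E (c *: a)) ->
    (forall a d, E a -> E d -> E (a * d)) ->
    E (sub_one E) ->
  mod_axioms E tact.
Proof.
move=> ED EZ EM E1E.
have tD a s t : E a -> tact a (s + t) = tact a s + tact a t.
  by move=> Ea; rewrite tactE tliftD //; apply: tact_balanced.
split=> [a Ea v w|a Ea c v|a d Ea Ed|c a Ea|a d Ea Ed|].
- exact: tD.
- by rewrite tactE tliftZ //; apply: tact_balanced.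
- apply: tensor_ind => [|s t IHs IHt|e v Ae].
  + by rewrite !tact0 ?addr0 //; apply: ED.
  + by rewrite !tD ?IHs ?IHt 1?addrACA //; apply: ED.
  + rewrite !tact_pure //; last exact: ED.
    by rewrite mulrDl (balDl tp) //; apply: EA.
- apply: tensor_ind => [|s t IHs IHt|e v Ae].
  + by rewrite !tact0 ?scaler0 //; apply: EZ.
  + by rewrite !tD ?IHs ?IHt ?scalerDr //; apply: EZ.
  + rewrite !tact_pure //; last exact: EZ.
    by rewrite -scalerAl (balZl tp) //; apply: EA.
- apply: tensor_ind => [|s t IHs IHt|e v Ae].
  + by rewrite !tact0 //; apply: EM.
  + by rewrite !tD ?IHs ?IHt //; apply: EM.
  + by rewrite !tact_pure ?mulrA //; first [exact: EM | exact: EA].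
- apply: tensor_ind => [|s t IHs IHt|e v Ae]; first by rewrite tact0.
  + by rewrite tD ?IHs ?IHt.
  + by rewrite tact_pure // E1.
Qed.

End LeftAction.
End Tensor.

Section GroupModules.
Variables (O : comNzRingType) (X : finGroupType).
Local Notation R := (galg O X).

Definition galgO (H : {set X}) : subalg R := Subalg (supported H) 1.

Lemma supportedD (H : {set X}) (x y : R) :
  supported H x -> supported H y -> supported H (x + y).
Proof. by move=> Hx Hy g Hg; rewrite ffunE Hx ?Hy ?addr0. Qed.

Lemma supportedZ (H : {set X}) (c : O) (x : R) :
  supported H x -> supported H (c *: x).
Proof. by move=> Hx g Hg; rewrite ffunE Hx ?scaler0. Qed.

Lemma supported1 (H : {group X}) : supported H (1 : R).
Proof.
move=> g Hg; rewrite ffunE; case: eqP Hg => // ->.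
by rewrite group1.
Qed.

Lemma supportedS (L H : {set X}) (x : R) :
  L \subset H -> supported L x -> supported H x.
Proof. by move=> /subsetP LH Lx g Hg; apply/Lx/(contra (LH g)). Qed.

Definition triv_act (x : R) (c : O^o) : O^o := aug x * c.

Lemma triv_axioms (H : {group X}) : mod_axioms (galgO H) triv_act.
Proof.
rewrite /triv_act; split=> [a _ v w|a _ c v|a d _ _ v|c a _ v|a d _ _ v|v].
- exact: mulrDr.
- exact: mulrCA.
- by rewrite augD; apply: mulrDl.
- by rewrite augZ; apply/esym/mulrA.
- by rewrite augM; apply/esym/mulrA.
- by rewrite /= aug1; apply: mul1r.
Qed.

Definition triv_mod (H : {group X}) : module (galgO H) :=
  Module (triv_axioms H).

(* Ind_P^H(O) = OH (x)_OP O *)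
Lemma ind_triv_axioms (H P : {group X}) (sPH : P \subset H) :
  mod_axioms (galgO H)
    (@tact O R (supported H) (supported P) O^o triv_act).
Proof.
apply: tact_axioms => /=; try exact: supportedM; try exact: supportedD.
- exact: supportedZ.
- by move=> a r Ha /(supportedS sPH); apply: supportedM.
- by move=> a _; rewrite mul1r.
- exact: supportedZ.
- exact: supported1.
Qed.

Definition ind_triv (H P : {group X}) (sPH : P \subset H) :
  module (galgO H) := Module (ind_triv_axioms sPH).

Lemma res_axioms (H L : {group X}) (sLH : L \subset H)
  (V : module (galgO H)) : mod_axioms (galgO L) (@mod_act _ _ _ V).
Proof.
have sS (x : R) : supported L x -> supported H x by apply: supportedS sLH.
have [VD VZ DV ZV MV V1] := mod_actP V.
by split=> [a /sS|a /sS|a d /sS + /sS|c a /sS|a d /sS + /sS|] => *;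
  [apply: VD|apply: VZ|apply: DV|apply: ZV|apply: MV|apply: V1].
Qed.

Definition res (H L : {group X}) (sLH : L \subset H) (V : module (galgO H)) :
  module (galgO L) := Module (res_axioms sLH V).

(* V is the Scott module Sc(H, P), which is determined up to isomorphism. *)
Definition is_scott (H P : {group X}) (V : module (galgO H)) : Prop :=
  exists sPH : P \subset H,
  [/\ indecomposable V, summand V (ind_triv sPH)
    & exists f : V -> triv_mod H, mod_hom f /\ forall c, exists v, f v = c].

End GroupModules.

(* The opposite group, so that galg O (X * opgroup Y) is OX (x) (OY)^op. *)
Definition opgroup (X : finGroupType) : Type := X.

Section OppositeGroup.
Variable X : finGroupType.
HB.instance Definition _ := Finite.on (opgroup X).

Definition op_mul (x y : opgroup X) : opgroup X := ((y : X) * (x : X))%g.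
Definition op_inv (x : opgroup X) : opgroup X := ((x : X)^-1)%g.

Fact op_mulA : associative op_mul.
Proof. by move=> x y z; rewrite /op_mul mulgA. Qed.
Fact op_mul1 : left_id (1%g : X) op_mul.
Proof. by move=> x; rewrite /op_mul mulg1. Qed.
Fact op_mulV : left_inverse (1%g : X) op_inv op_mul.
Proof. by move=> x; rewrite /op_mul /op_inv mulgV. Qed.

HB.instance Definition _ := Finite_isGroup.Build (opgroup X)
  op_mulA op_mul1 op_mulV.
End OppositeGroup.

Section TensorElement.
Variables (O : comNzRingType) (X Y : finGroupType).

(* x (x) y in OX (x) (OY)^op *)
Definition tens (x : galg O X) (y : galg O Y) : galg O (X * opgroup Y)%type :=
  [ffun g => x g.1 * y g.2].

Lemma tensM x y x' y' : tens x y * tens x' y' = tens (x * x') (y' * y).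
Proof.
apply/ffunP => -[g h]; rewrite galgME [RHS]ffunE /= !galgME.
pose F i j := tens x y (i, j) * tens x' y' ((i, j)^-1 * (g, h))%g.
rewrite (eq_bigr (fun p => F p.1 p.2)) => [|[] //].
rewrite -(pair_bigA _ F) big_distrl /=; apply: eq_bigr => i _.
rewrite big_distrr /= [RHS](reindex_inj (inj_comp (@mulgI Y h) (@invg_inj Y))).
apply: eq_bigr => j _; rewrite /F !ffunE /= mulrACA; congr (_ * _).
by rewrite mulrC; congr (y' _ * y _); rewrite invMg invgK mulgKV.
Qed.

End TensorElement.

Section Graded.
Variables (O : comNzRingType) (gT : finGroupType).
Local Notation R := (galg O gT).
Local Notation R2 := (galg O (gT * opgroup gT)%type).

Definition span (V : lmodType O) (P : V -> Prop) (v : V) : Prop :=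
  exists s : seq (O * V),
    (forall x, x \in s -> P x.2) /\ v = \sum_(x <- s) x.1 *: x.2.

(* b * OH as an algebra with identity b *)
Definition corner (b : R) (H : {set gT}) : subalg R :=
  Subalg (fun x => exists2 y, supported H y & x = b * y) b.

(* The x-component b * O[gN], x = gN, of b * OG.  For G' with G = N G', the
   component of b' * OG' at x is b' * O[gN'] for any g in G' with x = gN. *)
Definition component (b : R) (G N : {set gT}) (x : coset_of N) : R -> Prop :=
  corner b [set g in G | coset N g == x].

(* Delta(A (x) A'^op) for A = b * OG and A' = b' * OG', inside
   OG (x) (OG)^op *)
Definition delta_alg (b b' : R) (G G' N : {group gT}) : subalg R2 :=
  Subalg (span (fun z => exists x a a', [/\ x \in (G / N)%g,
            component b G x a, component b' G' (N := N) (x^-1)%g a'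
          & z = tens a a']))
    (tens b b').

(* internal direct sum decomposition, indexed by the elements of I *)
Definition is_grading (J : finType) (I : {set J}) (T : lmodType O)
    (Tx : J -> T -> Prop) : Prop :=
  (forall x, x \in I -> forall t, span (Tx x) t -> Tx x t) /\
  forall t, exists! F : {ffun J -> T},
    [/\ forall x, x \in I -> Tx x (F x),
        forall x, x \notin I -> F x = 0
      & t = \sum_(x in I) F x].

Definition is_bimodule (E E' : subalg R) (T : lmodType O)
    (lact : R -> T -> T) (ract : T -> R -> T) : Prop :=
  [/\ mod_axioms E lact,
      [/\ forall t a, E' a -> forall s, ract (t + s) a = ract t a + ract s a,
          forall t a (c : O), E' a -> ract (c *: t) a = c *: ract t a,
          forall t a d, E' a -> E' d -> ract t (a + d) = ract t a + ract t d
        & forall t a (c : O), E' a -> ract t (c *: a) = c *: ract t a],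
      forall t a d, E' a -> E' d -> ract t (a * d) = ract (ract t a) d,
      forall t, ract t (sub_one E') = t
    & forall a t d, E a -> E' d -> ract (lact a t) d = lact a (ract t d)].

End Graded.

Section GradedBimodule.
Variables (O : comNzRingType) (gT : finGroupType) (G G' N : {group gT}).
Local Notation R := (galg O gT).
Variables (b b' : R) (T : lmodType O).
Variables (lact : R -> T -> T) (ract : T -> R -> T).
Variable Tx : coset_of N -> T -> Prop.

Definition is_graded_bimodule : Prop :=
  [/\ is_bimodule (corner b G) (corner b' G') lact ract,
      is_grading (G / N)%g Tx
    & forall g x h, g \in (G / N)%g -> x \in (G / N)%g -> h \in (G / N)%g ->
      forall a t a', component b G g a -> Tx x t -> component b' G' h a' ->
        Tx (g * x * h)%g (ract (lact a t) a')].

(* OC_G(N) acts through c |-> b * c on the left and c |-> b' * c on the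
   right. *)
Definition over_centralizer : Prop :=
  forall g c t, g \in G -> c \in 'C_G(N)%g -> Tx (coset N g) t ->
    ract t (b' * gelt O c) = lact (b * gelt O (g * c * g^-1)%g) t.

End GradedBimodule.

Section InducedBimodule.
Variables (O : comNzRingType) (gT : finGroupType) (G G' N : {group gT}).
Local Notation R := (galg O gT).
Variables (b b' : R) (D : module (delta_alg b b' G G' N)).
Local Notation A := (corner b G).
Local Notation B := (corner b N).

(* A (x)_B D, where r in B acts on D as r (x) b' *)
Definition ind_delta : lmodType O :=
  tensor A B (fun r (d : D) => mod_act (tens r b') d).

Definition ind_delta_pure (a : R) (d : D) : ind_delta := tpure _ _ _ a d.

Definition ind_delta_lact (a : R) (t : ind_delta) : ind_delta := tact a t.

(* the image of A_x (x)_B D in A (x)_B D *)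
Definition ind_delta_comp (x : coset_of N) : ind_delta -> Prop :=
  span (fun t => exists a d, component b G x a /\ t = ind_delta_pure a d).

(* (a (x) d) a' = a u (x) (u^-1 (x) a') d *)
Definition ind_delta_ractP (ract : ind_delta -> R -> ind_delta) : Prop :=
  forall h u v a', h \in (G / N)%g ->
    component b G h u -> A v -> u * v = b -> v * u = b ->
    component b' G' h a' ->
  forall a d, A a ->
    ract (ind_delta_pure a d) a' = ind_delta_pure (a * u) (mod_act (tens v a') d).

Definition ind_delta_graded_over : Prop :=
  exists ract, [/\ ind_delta_ractP ract,
    is_graded_bimodule G G' b b' ind_delta_lact ract ind_delta_comp
  & over_centralizer G b b' ind_delta_lact ract ind_delta_comp].

End InducedBimodule.

Section Subgroups.
Variable gT : finGroupType.

Definition diag (Q : {set gT}) : {set gT * gT} := [set (q, q) | q in Q].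

Lemma diag_group_set (Q : {group gT}) : group_set (diag Q).
Proof.
apply/group_setP; split; first by apply/imsetP; exists 1%g.
move=> _ _ /imsetP[q Qq ->] /imsetP[r Qr ->].
by apply/imsetP; exists (q * r)%g; rewrite ?groupM.
Qed.

Canonical diag_group (Q : {group gT}) := Group (diag_group_set Q).

Lemma setX_sub_fibre (G N G' N' : {group gT}) (K : {group gT * gT}) :
  (N <| G)%g -> N' = G' :&: N :> {set gT} ->
  K = [set x in setX G G' | coset N x.1 == coset N x.2] :> {set gT * gT} ->
  setX N N' \subset K.
Proof.
move=> /andP[sNG _] -> ->; apply/subsetP => -[n n'].
rewrite !inE /= => /andP[Nn /andP[G'n' Nn']].
by rewrite (subsetP sNG) // G'n' !coset_id //=.
Qed.

End Subgroups.

(* Main.v *)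
Require Import Defs.
From HB Require Import structures.
From mathcomp Require Import all_boot all_order all_algebra all_fingroup.
From mathcomp Require Import all_solvable fraction.
From mathcomp Require Import ring.
From mathcomp Require Import boolp.

(* Write L = N x N', P = Delta Q and T = Ind_{Delta G'}^K(O).  Over the complete
   discrete valuation ring O, every endomorphism phi of an indecomposable direct
   summand V of a permutation module has phi or 1 - phi invertible.  Since
   p does not divide |G' : Q|, the transfer maps exhibit Sc(K, P) as a direct
   summand of T; since K = L Delta G', all L-homomorphisms T -> O are multiples
   of the augmentation, so Res_L Sc(K, P) has only one homomorphism to O up to
   scalars and M = Sc(L, P) is a direct summand of it.  Averaging a projection
   onto M over K / L shows that Res_L Sc(K, P) divides a power of M, so a
   complement of M would have a further nonzero homomorphism to O.

   The principal blocks act as identity on M, because their augmentations are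
   nonzero.  The right action of g in G' on A (x)_B M is
   (a (x) m) g = a g (x) (g^-1, g^-1) m.  For c in C_G(N), the element (c, c)
   fixes T = (O(N x 1)) (1 (x) 1) pointwise, whence the statement on C. *)

Set Implicit Arguments.
Unset Strict Implicit.
Unset Printing Implicit Defensive.

Import GRing.Theory.
Local Open Scope ring_scope.

(** Krull-Schmidt and the theory of vertices are replaced by one test. If [V] has local
    endomorphisms, [f] is a nonzero homomorphism on [V] and [f phi = f], then [phi] is invertible,
    because [f] kills the image of [1 - phi]. Taking for [f] a map to O, each splitting reduces to
    evaluating one scalar. With H = Delta G', the scalars that occur are |H : P|, |H :&: L : P| and
    |K / L|. The last two multiply to |G' : Q|, which is also the first, so all of them are prime to
    [p] and hence units of O. The averaging over K / L works because each conjugate of the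
    projection onto M factors through M: the conjugates preserve the same map to O, so the test
    applies to their compressions to M as well. *)

Section PiAdic.
Variables (O : idomainType) (pi : O).
Hypotheses (pi_unif : uniformizer pi)
  (Ocomplete : forall a, adic_cauchy pi a -> exists l, adic_limit pi a l).

Lemma pow_dvdD n x y : pow_dvd pi n x -> pow_dvd pi n y -> pow_dvd pi n (x + y).
Proof. by move=> [u ->] [v ->]; exists (u + v); rewrite mulrDr. Qed.

Lemma pow_dvd_separated x : (forall n, pow_dvd pi n x) -> x = 0.
Proof.
have [pi0 piU pi_dec] := pi_unif => x_pi; apply/eqP/negPn/negP => x0.
have [n [u [uU Dx]]] := pi_dec x x0; have [y] := x_pi n.+1.
rewrite Dx mulrC exprSr -mulrA => /(mulfI (expf_neq0 n pi0)) Du.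
by move: uU; rewrite Du unitrM (negPf piU).
Qed.

Lemma nonunit_pow_dvd x : x \isn't a GRing.unit -> pow_dvd pi 1 x.
Proof.
have [pi0 piU pi_dec] := pi_unif => xU.
have [->|/pi_dec[[|n] [u [uU Dx]]]] := eqVneq x 0; first by exists 0; rewrite mulr0.
  by rewrite Dx mulr1 uU in xU.
by exists (u * pi ^+ n); rewrite Dx exprS; ring.
Qed.

(** * Congruences and limits of matrices modulo powers of [pi] *)

Definition mx_pow_dvd n m (A : 'M[O]_m) := exists B, A = pi ^+ n *: B.

Lemma mx_pow_dvdP n m (A : 'M[O]_m) :
  mx_pow_dvd n A <-> forall i j, pow_dvd pi n (A i j).
Proof.
split=> [[B ->] i j|A_pi]; first by exists (B i j); rewrite mxE.
exists (\matrix_(i, j) sval (cid (A_pi i j))); apply/matrixP => i j.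
by rewrite !mxE; case: cid.
Qed.

Lemma mx_pow_dvdD n m (A B : 'M[O]_m) :
  mx_pow_dvd n A -> mx_pow_dvd n B -> mx_pow_dvd n (A + B).
Proof. by move=> [C ->] [D ->]; exists (C + D); rewrite scalerDr. Qed.

Lemma mx_pow_dvdN n m (A : 'M[O]_m) : mx_pow_dvd n A -> mx_pow_dvd n (- A).
Proof. by move=> [C ->]; exists (- C); rewrite scalerN. Qed.

Lemma mx_pow_dvdMl n m (A B : 'M[O]_m) :
  mx_pow_dvd n A -> mx_pow_dvd n (B *m A).
Proof. by move=> [C ->]; exists (B *m C); rewrite -scalemxAr. Qed.

Lemma mx_pow_dvdMr n m (A B : 'M[O]_m) :
  mx_pow_dvd n A -> mx_pow_dvd n (A *m B).
Proof. by move=> [C ->]; exists (C *m B); rewrite -scalemxAl. Qed.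

Lemma mx_pow_dvdW n n' m (A : 'M[O]_m) : (n' <= n)%N ->
  mx_pow_dvd n A -> mx_pow_dvd n' A.
Proof.
by move=> /subnKC <- [C ->]; exists (pi ^+ (n - n') *: C); rewrite scalerA exprD.
Qed.

Lemma mx_pow_dvd_separated m (A : 'M[O]_m) : (forall n, mx_pow_dvd n A) -> A = 0.
Proof.
move=> A_pi; apply/matrixP => i j; rewrite mxE.
by apply: pow_dvd_separated => n; have /mx_pow_dvdP := A_pi n; apply.
Qed.

Lemma mx_adic_limit m (e : nat -> 'M[O]_m) :
  (forall n, mx_pow_dvd n.+1 (e n.+1 - e n)) ->
  exists l, forall n, mx_pow_dvd n.+1 (l - e n).
Proof.
move=> e_step.
have e_cauchy n d : mx_pow_dvd n.+1 (e (n + d)%N - e n).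
  elim: d => [|d IHd]; first by exists 0; rewrite addn0 subrr scaler0.
  have -> : e (n + d.+1)%N - e n = (e (n + d).+1 - e (n + d)%N) + (e (n + d)%N - e n).
    by rewrite addnS addrA subrK.
  by apply: mx_pow_dvdD => //; apply: mx_pow_dvdW (e_step _); rewrite ltnS leq_addr.
have e_cauchy2 i j : adic_cauchy pi (fun n => e n i j).
  move=> n; exists n => r s nr ns.
  have /mx_pow_dvdP/(_ i j) : mx_pow_dvd n (e r - e s).
    have -> : e r - e s = (e r - e n) - (e s - e n) by rewrite opprB addrA subrK.
    rewrite -(subnKC nr) -(subnKC ns).
    by apply: mx_pow_dvdD; [|apply: mx_pow_dvdN]; apply: mx_pow_dvdW (e_cauchy _ _).
  by rewrite !mxE.
pose l := \matrix_(i, j) sval (cid (Ocomplete (e_cauchy2 i j))).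
exists l => n; apply/mx_pow_dvdP => i j; rewrite !mxE.
(* Past [m0] the sequence is close to its limit; past [n] the telescoping bound applies. The maximum
   serves both. *)
case: cid => x /= /(_ n.+1) [m0 /(_ (maxn m0 n) (leq_maxl _ _)) lim].
have -> : x - e n i j = - (e (maxn m0 n) i j - x) + (e (maxn m0 n) i j - e n i j).
  by rewrite opprB addrA subrK.
apply: pow_dvdD; first by case: lim => y ->; exists (- y); rewrite mulrN.
have /mx_pow_dvdP/(_ i j) := e_cauchy n (maxn m0 n - n)%N.
by rewrite subnKC ?leq_maxr // !mxE.
Qed.

(* Newton iteration for the polynomial X^2 - X *)
Definition idem_lift (q : {poly O}) := 3%:R * q ^+ 2 - 2%:R * q ^+ 3.

Lemma mx_idempotent_lift m (X : 'M[O]_m.+1) (r : {poly O}) :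
  mx_pow_dvd 1 (horner_mx X ((r * 'X) ^+ 2 - r * 'X)) ->
  exists e, [/\ e *m e = e,
    mx_pow_dvd 1 (e - horner_mx X (r * 'X)),
    forall Y, X *m Y = Y *m X -> e *m Y = Y *m e,
    forall Y, Y *m X = X -> Y *m e = e
  & forall Y, X *m Y = X -> e *m Y = e].
Proof.
set q := r * 'X => q_idem.
pose s n := iter n idem_lift q; pose e n := horner_mx X (s n).
have s_idem n : mx_pow_dvd n.+1 (horner_mx X (s n ^+ 2 - s n)).
  elim: n => // n IHn; rewrite /= -/(s n) /idem_lift.
  set t := s n in IHn *.
  have -> : (3%:R * t ^+ 2 - 2%:R * t ^+ 3) ^+ 2 - (3%:R * t ^+ 2 - 2%:R * t ^+ 3)
     = (t ^+ 2 - t) * ((t ^+ 2 - t) * (4%:R * t ^+ 2 - 4%:R * t - 3%:R)) by ring.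
  rewrite !rmorphM /= -/(s n); have [B ->] := IHn.
  (* The error is squared, giving 2n + 2 powers of [pi]; only n + 2 of them are kept. *)
  exists (pi ^+ n *: (B * (B * horner_mx X (4%:R * t ^+ 2 - 4%:R * t - 3%:R)))).
  by rewrite -!scalerAl -!scalerAr !scalerA -!exprD addSnnS addnC.
have e_step n : mx_pow_dvd n.+1 (e n.+1 - e n).
  rewrite /e -rmorphB /=.
  have -> : s n.+1 - s n = (s n ^+ 2 - s n) * (1 - 2%:R * s n).
    by rewrite /s /= -/(s n) /idem_lift; ring.
  by rewrite rmorphM; apply: mx_pow_dvdMr.
have [l l_lim] := mx_adic_limit e_step.
(* Continuity: additive maps that respect congruences and agree on all [e n] agree at the limit
   [l]. *)
have l_eq (f g : 'M[O]_m.+1 -> 'M[O]_m.+1) :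
    (forall n A, mx_pow_dvd n A -> mx_pow_dvd n (f A) /\ mx_pow_dvd n (g A)) ->
    {morph f : A B / A + B} -> {morph g : A B / A + B} ->
    (forall n, f (e n) = g (e n)) -> f l = g l.
  move=> fg fD gD fge; apply/eqP; rewrite -subr_eq0; apply/eqP.
  apply: mx_pow_dvd_separated => n; rewrite -(subrK (e n) l) fD gD fge.
  rewrite opprD addrACA subrr addr0; have [fl gl] := fg _ _ (l_lim n).
  by apply: (mx_pow_dvdW (leqnSn n)); apply: mx_pow_dvdD => //; apply: mx_pow_dvdN.
have s_X n : exists t, s n = t * 'X.
  elim: n => [|n [t Dt]]; first by exists r.
  exists (t * (3%:R * s n - 2%:R * s n ^+ 2)); rewrite /= -/(s n) /idem_lift.
  by rewrite [in RHS]mulrAC -Dt; ring.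
exists l; split=> [||Y XY|Y XY|Y XY].
- apply/eqP; rewrite -subr_eq0; apply/eqP/mx_pow_dvd_separated => n.
  apply: (mx_pow_dvdW (leqnSn n)).
  have -> : l *m l - l = (l - e n) *m l + e n *m (l - e n) - (l - e n)
      + horner_mx X (s n ^+ 2 - s n).
    rewrite rmorphB rmorphXn /= -/(e n) expr2 -[e n * e n]/(e n *m e n).
    rewrite mulmxBl mulmxBr [l *m l - _ + _]addrA subrK addrAC.
    by rewrite [l *m l - _ + _]addrA subrK opprB addrA subrK.
  apply: mx_pow_dvdD => //; apply: mx_pow_dvdD; last exact: mx_pow_dvdN.
  by apply: mx_pow_dvdD; [apply: mx_pow_dvdMr | apply: mx_pow_dvdMl].
- exact: l_lim 0%N.
- apply: (l_eq (fun A => A *m Y) (fun A => Y *m A)) => [n A dA|A B|A B|n].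
  + by split; [apply: mx_pow_dvdMr | apply: mx_pow_dvdMl].
  + exact: mulmxDl.
  + exact: mulmxDr.
  + exact: comm_horner_mx.
- apply: (l_eq (fun A => Y *m A) id) => [n A dA|A B||n] //.
  + by split; first apply: mx_pow_dvdMl.
  + exact: mulmxDr.
  + have [t Dt] := s_X n; rewrite /e Dt mulrC rmorphM /= horner_mx_X.
    by rewrite -[_ * _]/(X *m _) mulmxA XY.
- apply: (l_eq (fun A => A *m Y) id) => [n A dA|A B||n] //.
  + by split; first apply: mx_pow_dvdMr.
  + exact: mulmxDl.
  + have [t Dt] := s_X n; rewrite /e Dt rmorphM /= horner_mx_X.
    by rewrite -[_ * _]/(_ *m X) -mulmxA XY.
Qed.

End PiAdic.

(** * Reduction to the residue field and Fitting's idempotent *)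

Section Fitting.
Variables (O : idomainType) (k : fieldType) (red : {rmorphism O -> k}).
Hypotheses (Ocomplete : complete_dvr O) (red_surj : forall y, exists x, red x = y)
  (red0P : forall x, red x = 0 <-> x \isn't a GRing.unit).

Lemma unit_red x : (x \is a GRing.unit) = (red x != 0).
Proof.
apply/idP/idP => [xU|]; first by apply/eqP => /red0P; rewrite xU.
by apply: contraNT => /red0P/eqP.
Qed.

Lemma unitmx_red m (A : 'M[O]_m) : (A \in unitmx) = (map_mx red A \in unitmx).
Proof. by rewrite !unitmxE det_map_mx unitfE unit_red. Qed.

Lemma poly_red_lift (q : {poly k}) : exists r, map_poly red r = q.
Proof.
elim/poly_ind: q => [|q c [r <-]]; first by exists 0; rewrite rmorph0.
have [d <-] := red_surj c; exists (r * 'X + d%:P).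
by rewrite rmorphD rmorphM /= map_polyX map_polyC.
Qed.

Lemma mx_fitting m (X : 'M[k]_m.+1) : exists u : {poly k},
  horner_mx X ((u * 'X) ^+ 2 - u * 'X) = 0
  /\ (horner_mx X (u * 'X) = 0 -> exists a, X ^+ a = 0).
Proof.
have [a [h /implyP h0 Dchi]] := multiplicity_XsubC (char_poly X) 0.
rewrite subr0 in Dchi.
have co_h : coprimep ('X ^+ a.+2) h.
  rewrite coprimep_sym coprimep_expr // -['X]subr0 -[0]/(0%:P) coprimep_XsubC h0 //.
  by rewrite monic_neq0 ?char_poly_monic.
have [[u v] /= Duv] := Bezout_eq1_coprimepP _ _ co_h.
have chi0 w : horner_mx X (w * (h * 'X^a)) = 0.
  by rewrite rmorphM /= -Dchi Cayley_Hamilton mulr0.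
exists (u * 'X^(a.+1)); split=> [|e0].
  rewrite -[RHS](chi0 (- u * v * 'X^2)); congr horner_mx.
  have Du : u * 'X^(a.+1) * 'X = 1 - v * h by rewrite -Duv !exprS; ring.
  by rewrite expr2 {1}Du !exprS; ring.
exists a.+2; rewrite -[X]horner_mx_X -rmorphXn /= -['X^_]mul1r -Duv mulrDl.
rewrite rmorphD /= [X in _ + X](_ : _ = 0) ?addr0; last first.
  by rewrite -[RHS](chi0 (v * 'X^2)); congr horner_mx; rewrite !exprS; ring.
rewrite rmorphM /= [_ * 'X^(a.+2)](_ : _ = u * 'X^(a.+1) * 'X) ?e0 ?mul0r //.
by rewrite !exprSr; ring.
Qed.
End Fitting.

(** * Modules and indecomposability *)

Section FixedSubspace.
Variables (O : comNzRingType) (V : lmodType O) (q : {linear V -> V}).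

(** For an idempotent [q] this is its image; as a boolean predicate it gives a subtype carrying the
    module structure. *)
Definition fixp : {pred V} := fun v => q v == v.

Fact fixp_closed : submod_closed fixp.
Proof.
split=> [|c u v /eqP qu /eqP qv]; apply/eqP; first by rewrite linear0.
by rewrite linearP qu qv.
Qed.

HB.instance Definition _ := GRing.isSubmodClosed.Build O V fixp fixp_closed.

Record fixsub := FixSub { fixval : V; _ : fixval \in fixp }.
HB.instance Definition _ := [isSub for fixval].
HB.instance Definition _ := [Choice of fixsub by <:].
HB.instance Definition _ := [SubChoice_isSubZmodule of fixsub by <:].
HB.instance Definition _ := [SubZmodule_isSubLmodule of fixsub by <:].

End FixedSubspace.

Section Homomorphisms.
Variables (O : comNzRingType) (R : algType O) (E : subalg R).
Implicit Types U V W : module E.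

Lemma mod_hom_linear V W (f : V -> W) : mod_hom f ->
  exists g : {linear V -> W}, f = g.
Proof.
case=> fD fZ _.
have f_lin : linear f by move=> c u v; rewrite fD fZ.
pose h := GRing.isLinear.Build O V W *:%R f f_lin.
by exists (HB.pack_for {linear V -> W} f h).
Qed.

Lemma mod_hom0 V W (f : V -> W) : mod_hom f -> f 0 = 0.
Proof. by move=> /mod_hom_linear[g ->]; apply: linear0. Qed.

Lemma mod_homB V W (f : V -> W) : mod_hom f -> {morph f : u v / u - v}.
Proof. by move=> /mod_hom_linear[g ->]; apply: linearB. Qed.

Lemma mod_hom_sum V W (f : V -> W) I (s : seq I) P (F : I -> V) : mod_hom f ->
  f (\sum_(i <- s | P i) F i) = \sum_(i <- s | P i) f (F i).
Proof. by move=> /mod_hom_linear[g ->]; apply: linear_sum. Qed.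

Lemma mod_act_linear V a : E a -> exists g : {linear V -> V}, mod_act a = g.
Proof.
have [D Z _ _ _ _] := mod_actP V => Ea.
have f_lin : linear (@mod_act _ _ _ V a) by move=> c u v; rewrite D // Z.
pose h := GRing.isLinear.Build O V V *:%R _ f_lin.
by exists (HB.pack_for {linear V -> V} (@mod_act _ _ _ V a) h).
Qed.

Lemma mod_act_sum V a I (s : seq I) P (F : I -> V) : E a ->
  mod_act a (\sum_(i <- s | P i) F i) = \sum_(i <- s | P i) mod_act a (F i).
Proof. by move=> /(mod_act_linear V)[g ->]; apply: linear_sum. Qed.

Lemma mod_hom_id V : mod_hom (fun v : V => v).
Proof. by []. Qed.

Lemma mod_hom_comp U V W (f : V -> W) (g : U -> V) :
  mod_hom f -> mod_hom g -> mod_hom (fun u => f (g u)).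
Proof.
move=> [fD fZ fa] [gD gZ ga].
by split=> *; rewrite ?gD ?gZ ?ga ?fD ?fZ ?fa.
Qed.

Lemma mod_hom_add V W (f g : V -> W) : mod_hom f -> mod_hom g ->
  mod_hom (fun v => f v + g v).
Proof.
move=> [fD fZ fa] [gD gZ ga]; have [D _ _ _ _ _] := mod_actP W.
by split=> [v w|c v|a Ea v]; rewrite ?fD ?gD ?fZ ?gZ ?fa ?ga ?D ?scalerDr // addrACA.
Qed.

Lemma mod_hom_scale V W c (f : V -> W) : mod_hom f -> mod_hom (fun v => c *: f v).
Proof.
move=> [fD fZ fa]; have [_ Z _ _ _ _] := mod_actP W.
by split=> [v w|d v|a Ea v]; rewrite ?fD ?fZ ?fa ?Z ?scalerDr // !scalerA mulrC.
Qed.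

Lemma mod_hom_sub V W (f g : V -> W) : mod_hom f -> mod_hom g ->
  mod_hom (fun v => f v - g v).
Proof.
move=> fh gh; have := mod_hom_add fh (mod_hom_scale (-1) gh).
by congr mod_hom; apply/funext => v; rewrite scaleN1r.
Qed.

Lemma mod_hom_inv V W (f : V -> W) : mod_hom f -> bijective f ->
  exists g, [/\ mod_hom g, cancel f g & cancel g f].
Proof.
move=> [fD fZ fa] [g fK gK]; exists g; split=> //.
by split=> *; apply: (can_inj fK); rewrite ?fD ?fZ ?fa ?gK.
Qed.

Section FixedSubmodule.
Variables (V : module E) (q : {linear V -> V}) (hq : mod_hom q).

(** The default 0 can be reached only for [a] outside [E], where the action may leave the fixed
    points. *)
Definition fixsub_act a (v : fixsub q) : fixsub q := insubd 0 (mod_act a (val v)).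

Lemma val_fixsub_act a v : E a -> val (fixsub_act a v) = mod_act a (val v).
Proof.
case: hq => _ _ qa Ea; rewrite val_insubd ifT //; apply/eqP.
by rewrite qa //; congr mod_act; apply/eqP/(valP v).
Qed.

Fact fixsub_axioms : mod_axioms E fixsub_act.
Proof.
have [D Z Dl Zl M U] := mod_actP V.
have actE a (v : fixsub q) : mod_act a (val v) \in fixp q ->
  fixval (fixsub_act a v) = mod_act a (val v) by move=> h; rewrite [LHS]val_insubd h.
have actP a (v : fixsub q) : E a -> mod_act a (val v) \in fixp q.
  by move=> Ea; rewrite -val_fixsub_act //; apply: valP.
split=> [a Ea v w|a Ea c v|a d Ea Ed v|c a Ea v|a d Ea Ed v|v]; apply: val_inj => /=.
- by rewrite !val_fixsub_act //= D.
- by rewrite !val_fixsub_act //= Z.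
- by rewrite !actE ?Dl //= ?rpredD // actP.
- by rewrite !actE ?Zl //= ?rpredZ // actP.
- have adv : mod_act (a * d) (val v) = val (fixsub_act a (fixsub_act d v)).
    by rewrite val_fixsub_act // val_fixsub_act // M.
  by rewrite actE adv //; apply: valP.
- by rewrite actE ?U //; apply: (valP v).
Qed.

Definition fix_mod : module E := Module fixsub_axioms.
End FixedSubmodule.

Lemma indecomposable_idempotent V (q : V -> V) : indecomposable V ->
  mod_hom q -> (forall v, q (q v) = q v) ->
  (forall v, q v = 0) \/ (forall v, q v = v).
Proof.
move=> [_ V_ind] hq; have [q' Dq] := mod_hom_linear hq; subst q => qq.
have hr := mod_hom_sub (mod_hom_id V) hq.
have [r Dr] := mod_hom_linear hr; rewrite Dr in hr.
have qr v : r v = v - q' v by rewrite -Dr.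
have rq v : q' (r v) = 0 by rewrite qr linearB /= qq subrr.
have q_fix v : q' v \in fixp q' by apply/eqP.
have r_fix v : r v \in fixp r by apply/eqP; rewrite qr rq subr0.
pose f (v : V) : dsum (fix_mod hq) (fix_mod hr) := (FixSub (q_fix v), FixSub (r_fix v)).
pose g (w : dsum (fix_mod hq) (fix_mod hr)) : V := val w.1 + val w.2.
have fix_q (u : fix_mod hq) : q' (val u) = val u by apply/eqP/(valP u).
have fix_r (u : fix_mod hr) : r (val u) = val u by apply/eqP/(valP u).
have fK : cancel f g by move=> v; rewrite /g /= qr addrC subrK.
have gK : cancel g f.
  move=> [u w]; congr (_, _); apply: val_inj => /=.
    by rewrite linearD /= fix_q -[val w]fix_r rq addr0.
  by rewrite linearD /= fix_r qr fix_q subrr add0r.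
have fiso : isomorphic V (dsum (fix_mod hq) (fix_mod hr)).
  exists f; split; last by exists g.
  have [_ _ qa] := hq; have [_ _ ra] := hr.
  split=> [v w|c v|a Ea v]; congr (_, _); apply: val_inj;
    by rewrite /= ?linearD ?linearZ //= val_fixsub_act // ?qa ?ra.
have [u0|w0] := V_ind _ _ fiso; [left|right] => v.
  by have /(congr1 val) := u0 (f v).1.
by have /(congr1 val)/= := w0 (f v).2; rewrite qr => /eqP; rewrite subr_eq0 => /eqP.
Qed.
End Homomorphisms.

(** Finitely generated projective modules, as retracts of free ones. The rank is [m.+1] so that
    square matrices form a ring in which polynomials can be evaluated. *)
Definition finproj (O : comNzRingType) (V : lmodType O) : Prop :=
  exists m (i : {linear V -> 'rV[O]_m.+1}) (p : {linear 'rV[O]_m.+1 -> V}),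
    cancel i p.

Lemma finproj_summand (O : comNzRingType) (V W : lmodType O)
  (i : {linear V -> W}) (p : {linear W -> V}) : cancel i p -> finproj W -> finproj V.
Proof.
move=> iK [m [j [r jK]]].
exists m, [the {linear V -> _} of j \o i], [the {linear _ -> V} of p \o r].
by move=> v /=; rewrite jK iK.
Qed.

(** * Endomorphisms of indecomposable modules over a complete discrete valuation ring *)

Section LocalEndomorphisms.
Variables (O : idomainType) (k : fieldType) (red : {rmorphism O -> k}).
Hypotheses (Ocomplete : complete_dvr O) (red_surj : forall y, exists x, red x = y)
  (red0P : forall x, red x = 0 <-> x \isn't a GRing.unit).
Variables (R : algType O) (E : subalg R).

(* The idempotent of Fitting's decomposition of phi modulo the maximal ideal
   lifts to an idempotent commuting with everything that commutes with phi. *)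
Lemma indecomposable_local (V : module E) (phi : V -> V) :
  indecomposable V -> finproj V -> mod_hom phi ->
  bijective phi \/ bijective (fun v => v - phi v).
Proof.
have [pi [pi_unif pi_lim]] := Ocomplete.
move=> V_ind [m [i [p ip]]] phi_hom.
have [f Df] := mod_hom_linear phi_hom; subst phi.
(* An endomorphism [g] becomes the matrix of [i g p]; the identity of [V] becomes the idempotent
   [eps], which may differ from 1. *)
pose mx (g : {linear V -> V}) := lin1_mx [the {linear _ -> _} of i \o g \o p].
have mx_mul g v : v *m mx g = i (g (p v)) by rewrite mul_rV_lin1.
pose X := mx f; pose eps := mx idfun.
have red_pi A : mx_pow_dvd pi 1 A -> map_mx red A = 0 :> 'M_m.+1.
  case=> B ->; apply/matrixP => r s; rewrite !mxE rmorphM /= expr1.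
  by have [_ piU _] := pi_unif; rewrite ((red0P pi).2 piU) mul0r.
have [u [u_idem u_nil]] := mx_fitting (map_mx red X).
have [r Du] := poly_red_lift red_surj u.
have red_h q : map_mx red (horner_mx X q) = horner_mx (map_mx red X) (map_poly red q).
  exact: map_horner_mx.
have r_idem : mx_pow_dvd pi 1 (horner_mx X ((r * 'X) ^+ 2 - r * 'X)).
  apply/mx_pow_dvdP => j l; apply: (nonunit_pow_dvd pi_unif); apply/red0P.
  have red_q : map_poly red ((r * 'X) ^+ 2 - r * 'X) = (u * 'X) ^+ 2 - u * 'X.
    by rewrite rmorphB rmorphXn rmorphM /= map_polyX Du.
  have := red_h ((r * 'X) ^+ 2 - r * 'X); rewrite red_q u_idem.
  move/matrixP/(_ j l).
  by rewrite !mxE.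
have [e [ee e_r eC eL eR]] := mx_idempotent_lift pi_unif pi_lim r_idem.
have red_e : map_mx red e = horner_mx (map_mx red X) (u * 'X).
  have := red_pi _ e_r; rewrite map_mxB red_h [map_poly _ _]rmorphM /= map_polyX Du.
  by move/eqP; rewrite subr_eq0 => /eqP.
have mx_eq A B : (forall v : 'rV[O]_m.+1, v *m A = v *m B) -> A = B.
  by move=> AB; apply/row_matrixP => j; rewrite !rowE.
have epsX : eps *m X = X by apply: mx_eq => v; rewrite mulmxA !mx_mul ip.
have Xeps : X *m eps = X by apply: mx_eq => v; rewrite mulmxA !mx_mul ip.
have /eL eps_e := epsX; have /eR e_eps := Xeps.
(* As [eps *m e = e = e *m eps], the matrix [e] comes from an endomorphism [q] of [V]. It is a
   homomorphism because [e] commutes with every matrix that commutes with [X]. *)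
pose q v := p (i v *m e).
have q_hom : mod_hom q.
  split=> [v w|c v|a Ea v]; rewrite /q ?linearD ?mulmxDl ?linearD //.
    by rewrite linearZ -scalemxAl linearZ.
  have [g Dg] := mod_act_linear V Ea; rewrite Dg.
  have gX : X *m mx g = mx g *m X.
    apply: mx_eq => v'; rewrite !mulmxA !mx_mul !ip -Dg.
    by case: phi_hom => _ _ ->.
  have -> : i (g v) = i v *m mx g by rewrite mx_mul ip.
  by rewrite -mulmxA -eC // mulmxA mx_mul ip.
have iq w : i (p (w *m e)) = w *m e.
  by rewrite -[in RHS]e_eps mulmxA mx_mul.
have qq v : q (q v) = q v by rewrite /q iq -mulmxA ee.
have e_mul v : v *m e = i (q (p v)) by rewrite /q iq -[in LHS]eps_e mulmxA mx_mul.
(* The term [1 - eps] is the identity on the complement of [V], so an inverse of the sum restricts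
   to an inverse of [g]. *)
have bij_of (g : {linear V -> V}) : mx g + (1 - eps) \in unitmx -> bijective g.
  have p_eps w : p (w *m (1 - eps)) = 0.
    by rewrite mulmxBr mulmx1 mx_mul linearB /= ip subrr.
  have eps_i v : i v *m (1 - eps) = 0.
    by rewrite mulmxBr mulmx1 mx_mul /= ip subrr.
  set A := _ + _ => AU; exists (fun v => p (i v *m invmx A)) => v.
    have -> : i (g v) = i v *m A by rewrite mulmxDr eps_i addr0 mx_mul ip.
    by rewrite mulmxK // ip.
  rewrite -[RHS]ip -[i v in RHS](mulmxKV AU) mulmxDr linearD /= p_eps addr0.
  by rewrite mx_mul ip.
have [q0|q1] := indecomposable_idempotent V_ind q_hom qq; [right|left].
  have e0 : e = 0 by apply: mx_eq => v; rewrite e_mul q0 linear0 mulmx0.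
  (* Here the reduction of [X] is nilpotent, so [1 - X] is invertible by the geometric series. *)
  have [a Xa] : exists a, map_mx red X ^+ a = 0.
    by apply: u_nil; rewrite -red_e e0 map_mx0.
  apply: (bij_of [the {linear V -> V} of idfun \- f]).
  have -> : mx [the {linear V -> V} of idfun \- f] + (1 - eps) = 1 - X.
    apply: mx_eq => v; rewrite mulmxDr !mulmxBr !mulmx1 !mx_mul /= linearB /=.
    by rewrite addrC addrA subrK.
  rewrite (unitmx_red red0P) map_mxB map_mx1.
  have := subrX1 (map_mx red X) a; rewrite Xa sub0r => /(congr1 -%R).
  by rewrite opprK -mulNr opprB => /esym/mulmx1_unit[].
have e_eps1 : e = eps by apply: mx_eq => v; rewrite e_mul q1 mx_mul.
apply: bij_of; rewrite (unitmx_red red0P) map_mxD map_mxB map_mx1 -e_eps1 red_e.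
set Y := map_mx red X; rewrite -/(mx f) -/X -/Y; set W := horner_mx _ _.
pose U := horner_mx Y u.
have DW : W = U * Y by rewrite /W rmorphM /= horner_mx_X.
have UY : U * Y = Y * U by apply: comm_horner_mx.
have YW : Y * W = Y by rewrite -[W]red_e e_eps1 /Y -[_ * _]map_mxM Xeps.
have WW : W * W = W by rewrite {1}DW -mulrA YW.
have UW : U * W = W * U by rewrite DW {1}UY mulrA.
(* [W = U * Y] is the reduction of [eps]: on its image [U * W] inverts [Y], and on the complement
   both factors are the identity. *)
have : (Y + (1 - W)) * (U * W + (1 - W)) = 1.
  have W0 : (1 - W) * W = 0 by rewrite mulrBl mul1r WW subrr.
  rewrite mulrDl [Y * _]mulrDr [Y * (1 - W)]mulrBr mulr1 YW subrr addr0.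
  rewrite mulrA -UY -DW WW UW mulrDr mulrA W0 mul0r add0r.
  by rewrite mulrBr mulr1 W0 subr0 addrC subrK.
by move/mulmx1_unit => [].
Qed.
End LocalEndomorphisms.

Section LocalModules.
Variables (O : comNzRingType) (R : algType O) (E : subalg R).
Implicit Types U V W M : module E.

Definition local_mod V : Prop := forall phi : V -> V, mod_hom phi ->
  bijective phi \/ bijective (fun v => v - phi v).

(** The test that replaces Krull-Schmidt: otherwise [1 - phi] would be onto and [f] zero. *)
Lemma local_mod_bij M W (f : M -> W) (phi : M -> M) :
  local_mod M -> mod_hom f -> (exists v, f v != 0) -> mod_hom phi ->
  (forall v, f (phi v) = f v) -> bijective phi.
Proof.
move=> Mloc fh [v fv0] phih fphi; case: (Mloc _ phih) => // -[g _ gK].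
by rewrite -[v]gK (mod_homB fh) fphi subrr eqxx in fv0.
Qed.

(* If b != 0 then M would be a direct summand of the image of b, through which
   f would give a nonzero homomorphism. *)
Lemma local_mod_vanish V M W (f : M -> W) (b : V -> V) I (s : seq I)
    (al : I -> M -> V) (be : I -> V -> M) :
  local_mod M -> mod_hom f -> (exists v, f v != 0) ->
  (forall g : V -> W, mod_hom g -> forall v, g (b v) = 0) ->
  (forall t, mod_hom (al t)) -> (forall t, mod_hom (be t)) ->
  (forall t v, be t (b v) = be t v) ->
  (forall v, b v = \sum_(t <- s) al t (be t v)) -> forall v, b v = 0.
Proof.
move=> Mloc fh f0 b0; elim: s => [|t s IHs] in al *.
  by move=> _ _ _ Db v; rewrite Db big_nil.
move=> alh beh be_b Db.
have fbe v : f (be t v) = 0 by rewrite -be_b; apply: b0 (mod_hom_comp fh (beh t)) v.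
have phih := mod_hom_comp (beh t) (alh t).
have psih := mod_hom_sub (mod_hom_id M) phih.
(* [f] kills the image of [be t], so this map preserves [f] and is invertible. *)
have psi_bij : bijective (fun m => m - be t (al t m)).
  by apply: (local_mod_bij Mloc fh f0 psih) => m; rewrite (mod_homB fh) fbe subr0.
have [w [wh psiK wK]] := mod_hom_inv psih psi_bij.
have wbe r := mod_hom_comp (mod_hom_comp (alh t) wh) (mod_hom_comp (beh t) (alh r)).
apply: (IHs (fun r m => al r m + al t (w (be t (al r m))))) => // [r|v].
  exact: mod_hom_add.
(* Applying [be t] to the sum that expresses [b] and solving for [be t v] eliminates the index [t];
   the correction is absorbed into the remaining [al r]. *)
have be_t : be t v = \sum_(r <- s) w (be t (al r (be r v))).
  rewrite -(mod_hom_sum _ _ _ wh) -(mod_hom_sum _ _ _ (beh t)).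
  rewrite -[LHS]psiK; congr w; apply/eqP; rewrite subr_eq -{1}be_b Db big_cons.
  by have [-> _ _] := beh t; rewrite addrC.
rewrite Db big_cons {1}be_t (mod_hom_sum _ _ _ (alh t)) -big_split.
by apply: eq_bigr => r _; rewrite addrC.
Qed.
End LocalModules.

(** * Modules over group algebras, described by the action of group elements *)

Section GroupModules.
Variables (O : comNzRingType) (X : finGroupType).
Local Notation gelt := (gelt O).
Implicit Types H L K : {group X}.

Lemma galg_gelt (a : galg O X) : a = \sum_g a g *: gelt g.
Proof.
apply/ffunP => h; rewrite sum_ffunE (bigD1 h) //= big1 => [|g /negPf gh].
  by rewrite !ffunE eqxx addr0; apply/esym/mulr1.
by rewrite !ffunE eq_sym gh; apply: mulr0.
Qed.

Lemma supported_gelt H g : g \in H -> supported H (gelt g).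
Proof. by move=> Hg h Hh; rewrite ffunE; case: eqP Hh => // ->; rewrite Hg. Qed.

Lemma galg_gelt_sub (A : {set X}) (a : galg O X) : supported A a ->
  a = \sum_(g in A) a g *: gelt g.
Proof.
move=> Aa; rewrite {1}[a]galg_gelt (bigID (mem A)) /= [X in _ + X]big1 ?addr0 //.
by move=> g /Aa ->; rewrite scale0r.
Qed.

Lemma aug_gelt (g : X) : aug (gelt g) = 1.
Proof.
rewrite [LHS](bigD1 g) //= big1 => [|h /negPf hg]; rewrite ffunE ?hg //.
by rewrite eqxx addr0.
Qed.

Section OneModule.
Variables (H : {group X}) (V : module (galgO O H)).
Implicit Types v w : V.

Lemma mod_act_gelt (a : galg O X) v : supported H a ->
  mod_act a v = \sum_(g in H) a g *: mod_act (gelt g) v.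
Proof.
have [_ _ D Z _ _] := mod_actP V => Ha; rewrite {1}(galg_gelt_sub Ha).
have S0 : supported H (0 : galg O X) by move=> g; rewrite ffunE.
have act0 : mod_act (0 : galg O X) v = 0 by rewrite -(scale0r 0) Z ?scale0r.
have [_] : supported H (\sum_(g in H) a g *: gelt g) /\
    mod_act (\sum_(g in H) a g *: gelt g) v
    = \sum_(g in H) a g *: mod_act (gelt g) v; last by [].
elim/big_rec2: _ => // g x y Hg [Hy <-]; have Hgg := supported_gelt Hg.
split; first by apply: supportedD => //; apply: supportedZ.
by rewrite D ?Z //; apply: supportedZ.
Qed.

Lemma mod_act_geltM g h v : g \in H -> h \in H ->
  mod_act (gelt (g * h)) v = mod_act (gelt g) (mod_act (gelt h) v).
Proof.
have [_ _ _ _ M _] := mod_actP V => Hg Hh.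
by rewrite -M ?geltM //; apply: supported_gelt.
Qed.

Lemma mod_act_gelt1 v : mod_act (gelt 1) v = v.
Proof. by have [_ _ _ _ _] := mod_actP V; apply. Qed.

Lemma mod_act_geltKV g : g \in H ->
  cancel (@mod_act _ _ _ V (gelt g^-1)) (@mod_act _ _ _ V (gelt g)).
Proof.
by move=> Hg v; rewrite -mod_act_geltM ?groupV // mulgV mod_act_gelt1.
Qed.

End OneModule.

Lemma mod_hom_gelt H (V W : module (galgO O H)) (f : V -> W) :
  (forall v w, f (v + w) = f v + f w) -> (forall c v, f (c *: v) = c *: f v) ->
  (forall g, g \in H -> forall v, f (mod_act (gelt g) v) = mod_act (gelt g) (f v)) ->
  mod_hom f.
Proof.
move=> fD fZ fg; split=> // a Ha v; rewrite mod_act_gelt // [RHS]mod_act_gelt //.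
have f0 : f 0 = 0 by rewrite -(scale0r 0) fZ scale0r.
by rewrite (big_morph f fD f0); apply: eq_bigr => g Hg; rewrite fZ fg.
Qed.

Lemma mod_hom_triv H (V : module (galgO O H)) (f : V -> triv_mod O H) g v :
  mod_hom f -> g \in H ->
  f (mod_act (gelt g) v) = f v.
Proof.
case=> _ _ fa Hg; rewrite fa; last exact: supported_gelt.
by rewrite /= /triv_act aug_gelt mul1r.
Qed.

Lemma mod_hom_res H L (sLH : L \subset H) (V W : module (galgO O H)) (f : V -> W) :
  mod_hom f -> mod_hom (f : res sLH V -> res sLH W).
Proof. by case=> fD fZ fa; split=> // a La; apply/fa/(supportedS sLH La). Qed.

Lemma mod_hom_res_triv H L (sLH : L \subset H) (V : module (galgO O H))
    (f : V -> triv_mod O H) :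
  mod_hom f -> mod_hom (f : res sLH V -> triv_mod O L).
Proof. by case=> fD fZ fa; split=> // a La; apply/fa/(supportedS sLH La). Qed.

End GroupModules.

(** * Restriction to a normal subgroup of invertible index *)

Section Clifford.
Variables (O : comUnitRingType) (X : finGroupType) (K L : {group X}).
Hypotheses (nsLK : (L <| K)%g) (sLK : L \subset K).
Variable S : module (galgO O K).
Local Notation gelt := (gelt O).
Local Notation act g := (@mod_act _ _ _ S (gelt g)).

Lemma mod_hom_conj (p : S -> S) x : x \in K ->
  mod_hom (p : res sLK S -> res sLK S) ->
  mod_hom ((fun v => act x (p (act x^-1 v))) : res sLK S -> res sLK S).
Proof.
move=> Kx [pD pZ pa]; have [D Z _ _ _ _] := mod_actP S.
have Kx' : x^-1%g \in K by rewrite groupV.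
have [sx sx'] := (supported_gelt O Kx, supported_gelt O Kx').
apply: mod_hom_gelt => [v w|c v|g Lg v].
- by rewrite D // pD D.
- by rewrite Z // pZ Z.
have Kg := subsetP sLK g Lg.
have Lgx : (g ^ x)%g \in L by rewrite memJ_norm // (subsetP (normal_norm nsLK)).
have pgx : p (act (g ^ x) (act x^-1 v)) = act (g ^ x) (p (act x^-1 v)).
  exact: pa (supported_gelt O Lgx) _.
have Kgx := subsetP sLK _ Lgx.
rewrite /= -[act x^-1 (act g v)]mod_act_geltM // -[act g _]mod_act_geltM //.
have -> : (x^-1 * g = g ^ x * x^-1)%g by rewrite /conjg !mulgA mulgK.
rewrite [act (_ * x^-1) v]mod_act_geltM // pgx -[LHS]mod_act_geltM //.
by rewrite /conjg mulKVg.
Qed.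

(* independent of the choice of representatives when h commutes with L *)
Definition coset_avg (h : S -> S) (v : S) : S :=
  #|(K / L)%g|%:R^-1 *: \sum_(C in (K / L)%g) act (repr C) (h (act (repr C)^-1%g v)).

Lemma repr_quotient C : C \in (K / L)%g -> repr C \in K.
Proof.
by move=> KC; rewrite -(quotientGK nsLK) mem_morphpre ?repr_coset_norm //= coset_reprK.
Qed.

Lemma coset_avg_hom (h : S -> S) : mod_hom (h : res sLK S -> res sLK S) ->
  mod_hom (coset_avg h).
Proof.
move=> hh; have [D Z _ _ _ _] := mod_actP S.
have repK := repr_quotient.
apply: mod_hom_scale; pose F C v := act (repr C) (h (act (repr C)^-1%g v)).
have Fh C : C \in (K / L)%g -> mod_hom (F C : res sLK S -> res sLK S).
  by move=> KC; apply: mod_hom_conj (repK C KC) hh.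
(* Any representative may be used, so translation by [g] permutes the summands although [repr] is
   not multiplicative. *)
have F_rep x v : x \in K -> F (coset L x) v = act x (h (act x^-1 v)).
  move=> Kx; have : repr (coset L x) \in coset L x by apply: mem_repr_coset.
  rewrite val_coset ?(subsetP (normal_norm nsLK)) // => /rcosetP[l Ll Dr].
  have [Kl xv] := (subsetP sLK l Ll, groupVr Kx).
  rewrite /F Dr invMg !mod_act_geltM ?groupV //.
  have [_ _ xa] := mod_hom_conj Kx hh.
  rewrite -[act l (act x _)](xa _ (supported_gelt O Ll)) /=.
  by rewrite -/(mod_act _ _) [act l _]mod_act_geltKV.
apply: mod_hom_gelt => [v w|c v|g Kg v].
- by rewrite -big_split; apply: eq_bigr => C /Fh[FD _ _]; apply: FD.
- by rewrite scaler_sumr; apply: eq_bigr => C /Fh[_ FZ _]; apply: FZ.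
rewrite mod_act_sum; last exact: supported_gelt.
rewrite (reindex_inj (mulgI (coset L g))) /=; apply: eq_big => [C|C].
  by rewrite groupMl // mem_quotient.
rewrite groupMl ?mem_quotient // => KC.
have [Kx nLK] := (repK C KC, subsetP (normal_norm nsLK)).
have DC : (coset L g * C)%g = coset L (g * repr C).
  by rewrite -[in LHS](coset_reprK C) -morphM ?nLK.
have := F_rep (g * repr C)%g (act g v) (groupM Kg Kx); rewrite -DC /F => ->.
rewrite invMg -[act _ (act g v)]mod_act_geltM ?groupM ?groupV // mulgKV.
by rewrite mod_act_geltM.
Qed.

Hypothesis index_unit : #|(K / L)%g|%:R \is a (@GRing.unit O).

Lemma coset_avg_triv (h : S -> S) (f : S -> triv_mod O K) : mod_hom f ->
  (forall v, f (h v) = f v) -> forall v, f (coset_avg h v) = f v.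
Proof.
move=> fh fhv v; have [_ fZ _] := fh.
rewrite fZ (mod_hom_sum _ _ _ fh).
rewrite (eq_bigr (fun=> f v)) => [|C KC].
  by rewrite sumr_const -scaler_nat scalerA mulVr // scale1r.
have Kx := repr_quotient KC.
by rewrite !mod_hom_triv ?fhv ?mod_hom_triv ?groupV.
Qed.

(* If b = 1 - nu mu were nonzero then, the average of the conjugates of the
   projection nu mu onto M being invertible, b S would be a direct summand of a
   power of M; but all homomorphisms from S to O vanish on b S. *)
Lemma clifford_iso (M : module (galgO O L)) (fM : M -> triv_mod O L)
    (fS : S -> triv_mod O K) (mu : res sLK S -> M) (nu : M -> res sLK S) (u u' : O) :
  local_mod M -> local_mod S -> mod_hom fM -> mod_hom fS ->
  (exists m, fM m != 0) -> (exists v, fS v != 0) ->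
  (forall g : res sLK S -> triv_mod O L, mod_hom g ->
     exists c : O, forall v, g v = c *: fS v) ->
  mod_hom mu -> mod_hom nu -> u \is a GRing.unit -> u' \is a GRing.unit ->
  (forall v, fM (mu v) = u *: fS v) -> (forall m, fS (nu m) = u' *: fM m) ->
  bijective mu.
Proof.
move=> Mloc Sloc fMh fSh fM0 fS0 S_triv muh nuh uU u'U fMmu fSnu.
(* [mu nu] multiplies [fM] by [u * u']. Once normalised it is invertible, which corrects [nu] to a
   section [nu'] of [mu]. *)
have phih := mod_hom_scale (u * u')^-1 (mod_hom_comp muh nuh).
have [fSD fSZ fSa] := fSh; have [fMD fMZ fMa] := fMh.
have fMphi m : fM ((u * u')^-1 *: mu (nu m)) = fM m.
  by rewrite fMZ fMmu fSnu !scalerA -mulrA mulVr ?scale1r // unitrM uU.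
have [psi [psih psiK phiK]] := mod_hom_inv phih (local_mod_bij Mloc fMh fM0 phih fMphi).
pose nu' m : res sLK S := (u * u')^-1 *: nu (psi m).
have nuh' : mod_hom nu' := mod_hom_scale _ (mod_hom_comp nuh psih).
have munu m : mu (nu' m) = m by have [_ -> _] := muh; apply: phiK.
have fSnu' m : fS (nu' m) = u^-1 *: fM m.
  by rewrite fSZ fSnu -[m in RHS]phiK fMphi scalerA invrM // mulrC mulrA mulrV // mul1r.
pose h v := nu' (mu v); have hh : mod_hom h := mod_hom_comp nuh' muh.
have fSh_ v : fS (h v) = fS v by rewrite fSnu' fMmu scalerA mulVr // scale1r.
pose b v : res sLK S := v - h v.
have bh : mod_hom b := mod_hom_sub (mod_hom_id _) hh.
have bb v : b (b v) = b v.
  by rewrite {1 3}/b /h (mod_homB muh) munu subrr (mod_hom0 nuh') subr0.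
have avgh := coset_avg_hom hh.
have [w [wh avgK wK]] := mod_hom_inv avgh
  (local_mod_bij Sloc fSh fS0 avgh (coset_avg_triv fSh fSh_)).
have wLh := mod_hom_res sLK wh.
(* [b] projects onto the kernel of [mu], where [fS], and with it every homomorphism to O,
   vanishes. *)
have f0 : forall g : res sLK S -> triv_mod O L, mod_hom g -> forall v, g (b v) = 0.
  by move=> g /S_triv[c gc] v; rewrite gc (mod_homB fSh) fSh_ subrr scaler0.
pose hx x (v : res sLK S) : res sLK S := act x (h (act x^-1 v)).
have hxh x : x \in K -> mod_hom (hx x) by move=> Kx; apply: mod_hom_conj.
have fact x v : x \in K -> fS (act x v) = fS v by move=> Kx; apply: mod_hom_triv.
pose r (C : coset_of L) := if C \in (K / L)%g then repr C else 1%g.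
have Kr C : r C \in K.
  by rewrite /r; case: ifP => [/repr_quotient|_]; rewrite ?group1.
(* A conjugate of [h] still preserves [fS], so its compression to [M] is invertible. This makes each
   conjugate of [h] factor through [M] by homomorphisms over [L]. *)
have psi_ex C : exists ps, mod_hom ps /\
    forall m, ps (mu (hx (r C)^-1%g (nu' m))) = m.
  have xh := mod_hom_comp muh (mod_hom_comp (hxh _ (groupVr (Kr C))) nuh').
  have [|g [gh gK _]] := mod_hom_inv xh; last by exists g.
  apply: (local_mod_bij Mloc fMh fM0 xh) => m.
  by rewrite fMmu fact ?groupV // fSh_ fact ?invgK // fSnu' scalerA mulrV // scale1r.
have [ps psP] := choice psi_ex.
pose h2 C (v : res sLK S) : res sLK S := act (r C) (nu' (ps C (mu (act (r C)^-1 v)))).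
have h2h C : mod_hom (h2 C).
  apply: (mod_hom_conj (p := fun v => nu' (ps C (mu v)))) => //.
  by apply: mod_hom_comp nuh' (mod_hom_comp _ muh); have [] := psP C.
have hxE C v : hx (r C) v = h2 C (nu' (mu (hx (r C) v))).
  rewrite {1}/hx /h -[mu (act _ _) in LHS](psP C).2 /h2; congr (act _ (nu' (ps C (mu _)))).
  by rewrite /hx invgK.
(* With [w] inverse to the average of the conjugates of [h], [b] equals [b] after the average after
   [w b]. Expanding the average gives a sum of maps through [M], one for each coset. *)
pose al C m : res sLK S := #|(K / L)%g|%:R^-1 *: b (h2 C (nu' m)).
pose be C (v : res sLK S) := mu (hx (r C) (w (b v))).
have b_zero : forall v, b v = 0.
  apply: (local_mod_vanish (s := enum (K / L)%g) (al := al) (be := be)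
    Mloc fMh fM0 f0) => [C|C|C v|v].
  - exact: mod_hom_scale (mod_hom_comp bh (mod_hom_comp (h2h C) nuh')).
  - exact: mod_hom_comp muh (mod_hom_comp (hxh _ (Kr C)) (mod_hom_comp wLh bh)).
  - by rewrite /be bb.
  rewrite -bb -[b v in LHS]wK /coset_avg; have [_ -> _] := bh.
  rewrite (mod_hom_sum _ _ _ bh) scaler_sumr big_enum; apply: eq_bigr => C KC.
  by rewrite /al /be -hxE /r KC.
exists nu' => // v; apply/esym/eqP; rewrite -subr_eq0; apply/eqP/b_zero.
Qed.
End Clifford.

(** * Permutation modules *)

Section InducedTrivial.
Variables (O : comNzRingType) (X : finGroupType) (H P : {group X}).
Hypothesis sPH : P \subset H.
Local Notation R := (galg O X).
Local Notation gelt := (gelt O).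
Local Notation pure := (@tpure O R (supported H) (supported P) O^o (@triv_act O X)).

Definition ind_base : ind_triv O sPH := pure 1 1.

Fact ind_balanced :
  @balanced O R (supported H) (supported P) O^o (@triv_act O X) _ pure.
Proof.
apply: tensor_balanced => [a d|c a|a r Ha /(supportedS sPH)]; last exact: supportedM.
  exact: supportedD.
exact: supportedZ.
Qed.

Lemma ind_pure (a : R) (c : O) : supported H a ->
  pure a c = c *: @mod_act _ _ _ (ind_triv O sPH) a ind_base.
Proof.
move=> Ha; have [_ _ _ bZ _] := ind_balanced.
have H1 := @supported1 O X H.
rewrite [mod_act _ _](@tact_pure _ _ _ _ _ _ (galgO O H)) // ?mulr1.
- by rewrite -bZ //; congr tpure; apply/esym/mulr1.
- exact: supportedD.
- exact: supportedZ.
- by move=> b r Hb /(supportedS sPH); apply: supportedM.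
- exact: supportedM.
Qed.

Lemma ind_base_fixed x : x \in P -> mod_act (gelt x) ind_base = ind_base.
Proof.
move=> Px; have Hx := supported_gelt O (subsetP sPH x Px).
have [_ _ _ _ bM] := ind_balanced.
have := ind_pure 1 Hx; rewrite scale1r => <-.
rewrite -[gelt x]mul1r bM //; [|exact: supported1|exact: supported_gelt].
by rewrite /triv_act aug_gelt mul1r.
Qed.

Lemma ind_ext (W : lmodType O) (f g : ind_triv O sPH -> W) :
  (forall s t, f (s + t) = f s + f t) -> (forall c t, f (c *: t) = c *: f t) ->
  (forall s t, g (s + t) = g s + g t) -> (forall c t, g (c *: t) = c *: g t) ->
  (forall h, h \in H ->
     f (mod_act (gelt h) ind_base) = g (mod_act (gelt h) ind_base)) ->
  f =1 g.
Proof.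
move=> fD fZ gD gZ fg.
have f0 : f 0 = 0 by rewrite -(scale0r 0) fZ scale0r.
have g0 : g 0 = 0 by rewrite -(scale0r 0) gZ scale0r.
elim/tensor_ind => [|s t fs ft|a c Ha]; first by rewrite f0 g0.
  by rewrite fD fs ft gD.
rewrite ind_pure // mod_act_gelt // fZ gZ (big_morph f fD f0) (big_morph g gD g0).
by congr (_ *: _); apply: eq_bigr => h Hh; rewrite fZ gZ fg.
Qed.

Lemma ind_hom_ext (W : module (galgO O H)) (f g : ind_triv O sPH -> W) :
  mod_hom f -> mod_hom g -> f ind_base = g ind_base -> f =1 g.
Proof.
move=> [fD fZ fa] [gD gZ ga] fg.
by apply: ind_ext => // h /(supported_gelt O) Hh; rewrite fa // ga // fg.
Qed.

(** Frobenius reciprocity for the trivial module of [P]. *)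
Lemma ind_lift (W : module (galgO O H)) (w : W) :
  (forall x, x \in P -> mod_act (gelt x) w = w) ->
  exists f : ind_triv O sPH -> W, mod_hom f /\ f ind_base = w.
Proof.
move=> Pw; have [D Z Dl Zl M U] := mod_actP W.
have actP r : supported P r -> mod_act r w = aug r *: w.
  move=> Pr; rewrite (@mod_act_gelt _ _ _ (res sPH W)) //.
  rewrite [aug r](bigID (mem P)) /= [X in _ + X]big1 ?addr0; last by move=> g; apply: Pr.
  by rewrite scaler_suml; apply: eq_bigr => g /Pw; rewrite /= => ->.
pose F (a : R) (c : O^o) : W := (c : O) *: mod_act a w.
have Fb : balanced (supported H) (supported P) (@triv_act O X) F.
  split=> [a d Ha Hd c|a Ha c d|c a Ha d|a Ha c d|a r Ha Pr c]; rewrite /F.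
  - by rewrite Dl // scalerDr.
  - by rewrite scalerDl.
  - by rewrite Zl // !scalerA mulrC.
  - by rewrite scalerA.
  - have Hr := supportedS sPH Pr.
    by rewrite M // [mod_act r w]actP // Z // scalerA mulrC.
exists (tlift (act := @triv_act O X) F).
have FE a c : supported H a ->
    tlift (act := @triv_act O X) F (pure a c) = c *: mod_act a w.
  by move=> Ha; rewrite tlift_cls // feval_pure.
have FD s t := tliftD s t Fb; have FZ c t := tliftZ c t Fb.
split; last by rewrite FE ?U ?scale1r //; apply: supported1.
apply: mod_hom_gelt => // h Hh.
have Hg := supported_gelt O Hh; have [iD iZ _ _ _ _] := mod_actP (ind_triv O sPH).
apply: ind_ext => [s t|c t|s t|c t|g Kg].
- by rewrite iD // FD.
- by rewrite iZ // FZ.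
- by rewrite FD D.
- by rewrite FZ Z.
rewrite -mod_act_geltM //; have Hhg := groupM Hh Kg.
have actE x : x \in H -> mod_act (gelt x) ind_base = pure (gelt x) 1.
  by move=> Hx; rewrite ind_pure ?scale1r //; apply: supported_gelt.
rewrite !actE // !FE ?scale1r ?mod_act_geltM //; exact: supported_gelt.
Qed.

Lemma ind_aug : exists f : ind_triv O sPH -> triv_mod O H, mod_hom f /\ f ind_base = 1.
Proof. by apply: ind_lift => x _; rewrite /= /triv_act aug_gelt mul1r. Qed.

End InducedTrivial.

Section CosetSum.
Variables (O : comNzRingType) (X : finGroupType) (H P Q : {group X}).
Hypotheses (sPQ : P \subset Q) (sQH : Q \subset H).
Variables (W : module (galgO O H)) (w : W).
Local Notation gelt := (gelt O).
Hypothesis wP : forall x, x \in P -> mod_act (gelt x) w = w.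

(** The relative trace from [P] to [Q] of the [P]-fixed element [w]. *)
Definition coset_sum : W := \sum_(C in lcosets P Q) mod_act (gelt (repr C)) w.

Lemma repr_lcoset_act x : x \in Q ->
  mod_act (gelt (repr (x *: P)%g)) w = mod_act (gelt x) w.
Proof.
move=> Qx; have /lcosetP[y Py ->] : repr (x *: P)%g \in (x *: P)%g.
  by apply: (mem_repr x); apply: lcoset_refl.
have [Hx Hy] := (subsetP sQH x Qx, subsetP sQH y (subsetP sPQ y Py)).
by rewrite mod_act_geltM // wP.
Qed.

Lemma coset_sum_fixed y : y \in Q -> mod_act (gelt y) coset_sum = coset_sum.
Proof.
move=> Qy; rewrite /coset_sum mod_act_sum; last first.
  exact/supported_gelt/(subsetP sQH).
have yK : cancel (fun C : {set X} => y *: C)%g (fun C : {set X} => y^-1 *: C)%g.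
  by move=> C; rewrite -lcosetM mulVg lcoset1.
rewrite [RHS](reindex_inj (can_inj yK)) /=; apply: eq_big => [C|C /lcosetsP[x Qx ->]].
  apply/lcosetsP/lcosetsP => [[x Qx ->]|[x Qx DC]].
    by exists (y * x)%g; rewrite ?groupM // lcosetM.
  by exists (y^-1 * x)%g; rewrite ?groupM ?groupV // lcosetM -DC yK.
have [Hx Hy] := (subsetP sQH x Qx, subsetP sQH y Qy).
by rewrite -lcosetM !repr_lcoset_act ?groupM // mod_act_geltM.
Qed.
End CosetSum.

Section FiniteRank.
Variables (O : comNzRingType) (X : finGroupType).
Local Notation gelt := (gelt O).

Lemma finproj_galg : finproj (galg O X).
Proof.
have cX : #|X| = #|X|.-1.+1.
  by rewrite prednK //; apply/card_gt0P; exists 1%g.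
pose i (x : galg O X) : 'rV[O]_(#|X|.-1.+1) :=
  \row_j x (enum_val (cast_ord (esym cX) j)).
pose q (r : 'rV[O]_(#|X|.-1.+1)) : galg O X :=
  [ffun g => r 0 (cast_ord cX (enum_rank g))].
have i_lin : linear i by move=> c x y; apply/rowP => j; rewrite !mxE !ffunE.
have q_lin : linear q by move=> c x y; apply/ffunP => g; rewrite !ffunE !mxE.
pose hi := GRing.isLinear.Build O (galg O X) 'rV[O]_(#|X|.-1.+1) *:%R i i_lin.
pose hq := GRing.isLinear.Build O 'rV[O]_(#|X|.-1.+1) (galg O X) *:%R q q_lin.
exists #|X|.-1, (HB.pack_for {linear galg O X -> 'rV[O]_(#|X|.-1.+1)} i hi),
  (HB.pack_for {linear 'rV[O]_(#|X|.-1.+1) -> galg O X} q hq).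
by move=> x; apply/ffunP => g; rewrite !ffunE mxE cast_ordK enum_rankK.
Qed.

Fact regular_axioms (H : {group X}) :
  mod_axioms (galgO O H) (fun a (x : galg O X) => a * x).
Proof.
split=> [a _|a _ c x|a d _ _ x|c a _ x|a d _ _ x|x]; rewrite ?mul1r ?mulrA //.
- exact: mulrDr.
- by rewrite -gscaleAr.
- exact: mulrDl.
- by rewrite -gscaleAl.
Qed.

Definition regular_mod (H : {group X}) : module (galgO O H) :=
  Module (regular_axioms H).

(** The base goes to the sum of the elements of [P] in the group algebra; a retraction reads off one
    coefficient for each left coset. *)
Lemma ind_finproj (H P : {group X}) (sPH : P \subset H) : finproj (ind_triv O sPH).
Proof.
pose sigma : regular_mod H := [ffun g => (g \in P)%:R].
have geltE g (x : galg O X) h : (gelt g * x) h = x (g^-1 * h)%g by apply: gmul_eltl.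
have sigmaP x : x \in P -> mod_act (gelt x) sigma = sigma.
  by move=> Px; apply/ffunP => g; rewrite geltE !ffunE groupMl ?groupV.
have [i [ih i1]] := ind_lift sPH sigmaP.
pose q (x : galg O X) : ind_triv O sPH :=
  \sum_(C in lcosets P H) x (repr C) *: mod_act (gelt (repr C)) (ind_base O sPH).
have q_lin : linear q.
  move=> c x y; rewrite scaler_sumr -big_split; apply: eq_bigr => C _.
  by rewrite !ffunE scalerDl scalerA.
have [il Di] := mod_hom_linear ih.
pose hq := GRing.isLinear.Build O (galg O X) _ *:%R q q_lin.
pose ql := HB.pack_for {linear galg O X -> ind_triv O sPH} q hq.
apply: (@finproj_summand O _ _ il ql) finproj_galg.
apply: ind_ext => // [s t|c t|h Hh]; rewrite ?linearD ?linearZ //=.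
rewrite -Di; have [_ _ ->] := ih; last exact: supported_gelt.
rewrite i1 /q (bigD1 (h *: P)%g) /=; last by apply/lcosetsP; exists h.
have fixP x : x \in P -> mod_act (gelt x) (ind_base O sPH) = ind_base O sPH.
  exact: ind_base_fixed.
have mem_rep (C : {set X}) x : C = (x *: P)%g -> repr C \in C.
  by move=> ->; apply: (mem_repr x); apply: lcoset_refl.
rewrite big1 => [|C /andP[/lcosetsP[x Hx DC] /eqP hC]]; last first.
  rewrite geltE ffunE; case: (boolP (_ \in P)) => [|_]; last by rewrite scale0r.
  rewrite -mem_lcoset => /lcoset_eqP hr; exfalso; apply: hC.
  by have := mem_rep _ _ DC; rewrite {2}DC => /lcoset_eqP; rewrite hr -DC.
rewrite addr0 geltE ffunE -mem_lcoset (mem_rep _ h) // scale1r.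
exact: (repr_lcoset_act sPH (subxx H) fixP).
Qed.
End FiniteRank.

(** As [P] lies in [L], right multiplication by O[P] respects the splitting of O[K] into the part
    supported on [L] and the rest. The map [r] is the projection onto the Mackey summand of the
    double coset of 1. *)
Lemma ind_restrict (O : comNzRingType) (X : finGroupType) (K L P : {group X})
    (sPL : P \subset L) (sPK : P \subset K) (sLK : L \subset K) :
  exists r : res sLK (ind_triv O sPK) -> ind_triv O sPL, mod_hom r /\
    forall x, x \in K -> r (mod_act (gelt O x) (ind_base O sPK)) =
      if x \in L then mod_act (gelt O x) (ind_base O sPL) else 0.
Proof.
pose cut (a : galg O X) : galg O X := [ffun g => if g \in L then a g else 0].
have cutL a : supported L (cut a) by move=> g /negPf Lg; rewrite ffunE Lg.
have cutD a d : cut (a + d) = cut a + cut d.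
  by apply/ffunP => g; rewrite !ffunE; case: ifP; rewrite ?addr0.
have cutZ c a : cut (c *: a) = c *: cut a.
  by apply/ffunP => g; rewrite !ffunE; case: ifP; rewrite ?scaler0.
have cutMr a r : supported P r -> cut (a * r) = cut a * r.
  move=> Pr; apply/ffunP => g; rewrite ffunE !galgME; case: ifP => Lg.
    apply: eq_bigr => h _; rewrite ffunE; case: ifP => // Lh.
    rewrite [X in _ * X]Pr ?mulr0 ?mul0r //; apply/negP => /(subsetP sPL).
    by rewrite groupMr // groupV Lh.
  rewrite big1 // => h _; rewrite ffunE; case: ifP => [Lh|]; last by rewrite mul0r.
  rewrite Pr ?mulr0 //; apply/negP => /(subsetP sPL).
  by rewrite groupMl ?groupV // Lg.
have cut_gelt x : cut (gelt O x) = if x \in L then gelt O x else 0.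
  apply/ffunP => g; rewrite ffunE [gelt O x g]ffunE; case: eqP => [->|/eqP gx].
    by case: ifP => _; rewrite !ffunE ?eqxx.
  by rewrite if_same; case: ifP => _; rewrite ?ffunE ?(negPf gx).
have [bD bDr bZ bZr bM] := ind_balanced O sPL.
pose F (a : galg O X) (c : O^o) : ind_triv O sPL :=
  @tpure O _ (supported L) (supported P) O^o (@triv_act O X) (cut a) c.
have Fb : balanced (supported K) (supported P) (@triv_act O X) F.
  split=> [a d _ _ c|a _ c d|c a _ d|a _ c d|a r _ Pr c]; rewrite /F.
  - by rewrite cutD bD.
  - by rewrite bDr.
  - by rewrite cutZ bZ.
  - by rewrite bZr.
  - by rewrite cutMr // bM.
pose r : res sLK (ind_triv O sPK) -> ind_triv O sPL :=
  tlift (act := @triv_act O X) F.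
have FD s t : r (s + t) = r s + r t by apply: tliftD.
have FZ c t : r (c *: t) = c *: r t by apply: tliftZ.
have rE x : x \in K -> r (mod_act (gelt O x) (ind_base O sPK)) =
      if x \in L then mod_act (gelt O x) (ind_base O sPL) else 0.
  move=> Kx; have Hx := supported_gelt O Kx.
  have := ind_pure sPK 1 Hx; rewrite scale1r => <-.
  rewrite /r tlift_cls // feval_pure // /F cut_gelt; case: ifP => Lx.
    by rewrite (ind_pure sPL) ?scale1r //; apply: supported_gelt.
  by rewrite -(scale0r 0) bZ ?scale0r // => g; rewrite ffunE.
exists r; split=> //; apply: mod_hom_gelt => // l Ll.
have Kl := subsetP sLK l Ll.
have [[D Z _ _ _ _] sl] := (mod_actP (ind_triv O sPK), supported_gelt O Kl).
have [[D' Z' _ _ _ _] sl'] := (mod_actP (ind_triv O sPL), supported_gelt O Ll).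
have act0 : mod_act (gelt O l) 0 = 0 :> ind_triv O sPL.
  by have [g ->] := mod_act_linear (ind_triv O sPL) sl'; rewrite linear0.
apply: ind_ext => [s t|c t|s t|c t|x Kx].
- by rewrite -FD; congr r; apply: D.
- by rewrite -FZ; congr r; apply: Z.
- by rewrite FD D'.
- by rewrite FZ Z'.
transitivity (r (mod_act (gelt O (l * x)%g) (ind_base O sPK))).
  by congr r; apply: esym (mod_act_geltM _ Kl Kx).
rewrite (rE _ (groupM Kl Kx)) (rE _ Kx) (groupMl x Ll).
by case: ifP => Lx; rewrite ?act0 // -mod_act_geltM.
Qed.

(** Each element of [K] is some [l * h]; [h] fixes the base and [g] is invariant under [l], so [g]
    is determined by its value at the base. *)
Lemma ind_res_triv (O : comNzRingType) (X : finGroupType) (K L H : {group X})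
    (sHK : H \subset K) (sLK : L \subset K)
    (e : ind_triv O sHK -> triv_mod O K)
    (g : res sLK (ind_triv O sHK) -> triv_mod O L) :
  K \subset (L * H)%g -> mod_hom e -> e (ind_base O sHK) = 1 -> mod_hom g ->
  forall t, g t = g (ind_base O sHK) *: e t.
Proof.
move=> sKLH eh e1 gh.
have [[eD eZ _] [gD gZ _]] := (eh, gh).
apply: ind_ext => // [s t|c t|x Kx]; rewrite ?eD ?scalerDr // ?eZ ?scalerA.
  by rewrite mulrC.
have /mulsgP[l h Ll Hh Dx] := subsetP sKLH x Kx.
have [Kl Kh] := (subsetP sLK l Ll, subsetP sHK h Hh).
rewrite (mod_hom_triv _ eh) // e1 Dx mod_act_geltM // ind_base_fixed //.
by rewrite (mod_hom_triv _ gh) // [RHS]mulr1.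
Qed.

(** All homomorphisms from the permutation module to O are multiples of [e], so the surjection [f]
    of the Scott module gives [f q = c e] with [c != 0]. Cancelling [c] in [f q i q = f q] leaves
    [e i q = e]. *)
Lemma scott_summand (O : idomainType) (X : finGroupType) (H P : {group X})
    (sPH : P \subset H) (V : module (galgO O H)) (e : ind_triv O sPH -> triv_mod O H) :
  is_scott P V -> mod_hom e -> e (ind_base O sPH) = 1 ->
  exists (i : V -> ind_triv O sPH) (q : ind_triv O sPH -> V),
    [/\ mod_hom i, mod_hom q, cancel i q & forall t, e (i (q t)) = e t].
Proof.
case=> sPH' [_ [W [phi [phih phi_bij]]] [f [fh f_surj]]] eh e1.
rewrite (bool_irrelevance sPH' sPH) in W phi phih phi_bij *.
have [psi [psih phiK psiK]] := mod_hom_inv phih phi_bij.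
have [[phD phZ pha] [psD psZ psa]] := (phih, psih).
pose i v := phi (v, 0); pose q t := (psi t).1.
have ih : mod_hom i.
  split=> [v w|c v|a Ea v]; rewrite /i.
  - by rewrite -phD; congr phi; congr (_, _); rewrite addr0.
  - by rewrite -phZ; congr phi; congr (_, _); rewrite scaler0.
  - rewrite -pha //; congr phi; congr (_, _) => /=.
    by have [g ->] := mod_act_linear W Ea; rewrite linear0.
have qh : mod_hom q by split=> *; rewrite /q ?psD ?psZ ?psa.
have iK : cancel i q by move=> v; rewrite /q phiK.
exists i, q; split=> // t.
have fqh := mod_hom_comp fh qh.
have fqE : forall s, f (q s) = f (q (ind_base O sPH)) *: e s.
  have sHHP : H \subset (H * P)%g by apply: mulG_subl.
  exact: (ind_res_triv sHHP eh e1 (mod_hom_res_triv (subxx H) fqh)).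
set c := f _ in fqE.
have c0 : c != 0.
  have [v fv] := f_surj 1; apply/eqP => c0; have := fqE (i v).
  by rewrite c0 scale0r iK fv; apply/eqP/oner_neq0.
apply: (mulfI c0); transitivity (f (q (i (q t)))); first exact/esym/fqE.
by rewrite iK fqE.
Qed.

(** * Scott modules *)

Section ScottRestriction.
Variables (O : idomainType) (k : fieldType) (red : {rmorphism O -> k}).
Hypotheses (Ocomplete : complete_dvr O) (red_surj : forall y, exists x, red x = y)
  (red0P : forall x, red x = 0 <-> x \isn't a GRing.unit).
Variable X : finGroupType.
Implicit Types H K L P Q : {group X}.

Lemma scott_local H P (V : module (galgO O H)) : is_scott P V -> local_mod V.
Proof.
move=> scV; have [sPH [V_ind _ _]] := scV.
have [e [eh e1]] := ind_aug O sPH.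
have [i [q [ih qh iK _]]] := scott_summand scV eh e1.
have [il Di] := mod_hom_linear ih; have [ql Dq] := mod_hom_linear qh.
subst i q => phi phih.
apply: (indecomposable_local Ocomplete red_surj red0P V_ind) => //.
exact: finproj_summand iK (ind_finproj O sPH).
Qed.

Lemma coset_sum_triv H P Q (sPQ : P \subset Q) (sQH : Q \subset H)
    (W : module (galgO O H)) (w : W) (f : W -> triv_mod O H) :
  mod_hom f -> f (coset_sum P Q w) = #|Q : P|%g%:R *: f w.
Proof.
move=> fh; rewrite (mod_hom_sum _ _ _ fh).
rewrite (eq_bigr (fun=> f w)) => [|C /lcosetsP[x Qx ->]].
  by rewrite sumr_const scaler_nat card_lcosets.
apply: mod_hom_triv => //; apply: (subsetP sQH).
have /lcosetP[y Py ->] : repr (x *: P)%g \in (x *: P)%g.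
  by apply: (mem_repr x); apply: lcoset_refl.
by rewrite groupM // (subsetP sPQ).
Qed.

(* Both Scott modules are compared with the permutation module of K / H, on
   which the only homomorphisms of L-modules to O are the multiples of the
   augmentation, because K = L H. *)
Lemma scott_res K L H P (nsLK : (L <| K)%g) (sLK : L \subset K)
    (sPH : P \subset H) (sHK : H \subset K) (sPL : P \subset L)
    (M : module (galgO O L)) (S : module (galgO O K)) :
  K \subset (L * H)%g -> #|(K / L)%g|%:R \is a (@GRing.unit O) ->
  #|H : P|%g%:R \is a (@GRing.unit O) -> #|H :&: L : P|%g%:R \is a (@GRing.unit O) ->
  is_scott P M -> is_scott P S ->
  (exists mu : res sLK S -> M, mod_hom mu /\ bijective mu) /\
  exists (j : S -> ind_triv O sHK) (q : ind_triv O sHK -> S),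
    [/\ mod_hom j, mod_hom q & cancel j q].
Proof.
move=> sKLH KL_unit HP_unit HLP_unit scM scS.
have [Mloc Sloc] := (scott_local scM, scott_local scS).
have sPK := subset_trans sPH sHK.
have [eY [eYh eY1]] := ind_aug O sPL.
have [eZ [eZh eZ1]] := ind_aug O sPK.
have [eT [eTh eT1]] := ind_aug O sHK.
have [i [p [ih ph iK eip]]] := scott_summand scM eYh eY1.
have [j0 [q0 [j0h q0h j0K ejq0]]] := scott_summand scS eZh eZ1.
(* [sigma] is the natural map from Ind_P^K O to Ind_H^K O and [kap] the transfer back; the former
   preserves augmentations, the latter multiplies them by |H : P|. *)
have [sigma [sigh sig1]] :=
  ind_lift sPK (fun x Px => ind_base_fixed O sHK (subsetP sPH x Px)).
have Zfix := coset_sum_fixed sPH sHK (ind_base_fixed O sPK).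
have [kap [kaph kap1]] := ind_lift sHK Zfix.
have [iot [ioth iot1]] :=
  ind_lift (W := res sLK (ind_triv O sPK)) sPL (ind_base_fixed O sPK).
have [r [rh rE]] := ind_restrict O sPL sPK sLK.
have eTsig t : eT (sigma t) = eZ t.
  by apply: (ind_hom_ext (mod_hom_comp eTh sigh) eZh) => /=; rewrite sig1 eT1 eZ1.
have eZkap t : eZ (kap t) = #|H : P|%g%:R *: eT t.
  apply: (ind_hom_ext (mod_hom_comp eZh kaph) (mod_hom_scale _ eTh)) => /=.
  by rewrite kap1 (coset_sum_triv _ _ _ eZh) // eZ1 eT1.
have eZiot t : eZ (iot t) = eY t.
  apply: (ind_hom_ext (mod_hom_comp (mod_hom_res_triv sLK eZh) ioth) eYh) => /=.
  by rewrite iot1 eZ1 eY1.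
pose n : O := #|H : P|%g%:R.
pose fS v := eZ (j0 v); have fSh : mod_hom fS := mod_hom_comp eZh j0h.
have [_ fSZ _] := fSh.
have fS0 : exists v, fS v != 0.
  by exists (q0 (ind_base O sPK)); rewrite /fS ejq0 eZ1 oner_neq0.
pose fM v := eY (i v); have fMh : mod_hom fM := mod_hom_comp eYh ih.
have fM0 : exists v, fM v != 0.
  by exists (p (ind_base O sPL)); rewrite /fM eip eY1 oner_neq0.
pose q1 t := n^-1 *: q0 (kap t).
have q1h : mod_hom q1 := mod_hom_scale _ (mod_hom_comp q0h kaph).
have fSq1 t : fS (q1 t) = eT t.
  by rewrite fSZ /fS ejq0 eZkap scalerA mulVr // scale1r.
(* The composite [q1 sigma j0] preserves [fS], so it is invertible on [S], which thereby splits off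
   Ind_H^K O. *)
have jh := mod_hom_comp sigh j0h.
have th := mod_hom_comp q1h jh.
have [th' [thh' thK th'K]] := mod_hom_inv th (local_mod_bij Sloc fSh fS0 th
  (fun v => etrans (fSq1 _) (eTsig _))).
pose q t := th' (q1 t); have qh : mod_hom q := mod_hom_comp thh' q1h.
have qK : cancel (fun v => sigma (j0 v)) q by move=> v; apply: thK.
have fSq t : fS (q t) = eT t.
  by rewrite -fSq1 -[q1 t in RHS]th'K fSq1 eTsig.
have T_triv (g : res sLK (ind_triv O sHK) -> triv_mod O L) : mod_hom g ->
    forall t, g t = g (ind_base O sHK) *: eT t.
  exact: (ind_res_triv (sLK := sLK) sKLH eTh eT1).
split; last by exists (fun v => sigma (j0 v)), q; split.
pose rk t := r (kap t).
have rkh : mod_hom (rk : res sLK (ind_triv O sHK) -> _).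
  exact: mod_hom_comp rh (mod_hom_res sLK kaph).
(* The transfer of the base is a sum over the cosets of [P] in [H]; [r] keeps those contained in
   [L], and |H :&: L : P| counts them. *)
have eYrk t : eY (rk t) = #|H :&: L : P|%g%:R *: eT t.
  have [rD rZ _] := rh; have [eYD eYZ _] := eYh.
  rewrite (T_triv _ (mod_hom_comp eYh rkh)) /rk kap1 (mod_hom_sum _ _ _ rh).
  rewrite (mod_hom_sum _ _ _ eYh); congr (_ *: _).
  have repr_mem (C : {set X}) x : C = (x *: P)%g -> repr C \in C.
    by move=> ->; apply: (mem_repr x); apply: lcoset_refl.
  rewrite (eq_bigr (fun C : {set X} => if repr C \in L then 1 else 0)); last first.
    move=> C /lcosetsP[x Hx DC]; rewrite rE; last first.
      have := repr_mem _ _ DC; rewrite {2}DC => /lcosetP[y Py ->].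
      by rewrite (subsetP sHK) // groupM // (subsetP sPH).
    case: ifP => Lr; last exact: (mod_hom0 eYh).
    by rewrite (mod_hom_triv _ eYh).
  rewrite -big_mkcondr sumr_const; congr (_%:R); rewrite -card_lcosets.
  apply: eq_card => C; apply/andP/lcosetsP => [[]|[x /setIP[Hx Lx] DC]].
    case/lcosetsP=> x Hx DC; have := repr_mem _ _ DC.
    rewrite {2}DC => /lcosetP[y Py ->]; rewrite groupMr ?(subsetP sPL y Py) // => Lx.
    by exists x; rewrite ?inE ?Hx.
  split; first by apply/lcosetsP; exists x.
  have := repr_mem _ _ DC; rewrite {2}DC => /lcosetP[y Py ->].
  by rewrite groupM // (subsetP sPL).
pose mu v := p (rk (sigma (j0 v))).
pose nu m := q (sigma (iot (i m))).
exists (mu : res sLK S -> M).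
have muh : mod_hom (mu : res sLK S -> M).
  exact: mod_hom_comp ph (mod_hom_comp rkh (mod_hom_res sLK jh)).
have nuh : mod_hom (nu : M -> res sLK S).
  apply: mod_hom_comp (mod_hom_res sLK (mod_hom_comp qh sigh)) (mod_hom_comp ioth ih).
split=> //.
apply: (clifford_iso nsLK KL_unit Mloc Sloc fMh fSh fM0 fS0 _ muh nuh HLP_unit (unitr1 O)).
- move=> g gh; exists (g (q (ind_base O sHK))) => v.
  have := T_triv _ (mod_hom_comp gh (mod_hom_res sLK qh)) (sigma (j0 v)).
  by rewrite qK eTsig.
- by move=> v; rewrite /fM /mu eip eYrk eTsig.
- by move=> m; rewrite scale1r /nu fSq eTsig eZiot.
Qed.
End ScottRestriction.

(** * Blocks and the twisted group algebra *)

Lemma gelt_mulE (O : comNzRingType) (X : finGroupType) (x : X) (a : galg O X) g :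
  (gelt O x * a) g = a (x^-1 * g)%g.
Proof. exact: gmul_eltl. Qed.

Lemma mul_geltE (O : comNzRingType) (X : finGroupType) (a : galg O X) x g :
  (a * gelt O x) g = a (g * x^-1)%g.
Proof.
rewrite galgME (bigD1 (g * x^-1)%g) //= big1 => [|h gh].
  by rewrite ffunE invMg invgK mulgKV eqxx addr0 mulr1.
rewrite ffunE; case: eqP => [Dx|_]; last by rewrite mulr0.
by move: gh; rewrite -Dx invMg invgK mulKVg eqxx.
Qed.

(** The action of [z] is an idempotent endomorphism, and [aug z != 0] keeps [f] nonzero on its
    image, so indecomposability leaves only the identity. *)
Lemma central_act (O : idomainType) (X : finGroupType) (H : {group X})
    (V : module (galgO O H)) (z : galg O X) (f : V -> triv_mod O H) :
  indecomposable V -> mod_hom f -> (exists v, f v != 0) ->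
  supported H z -> (forall h, h \in H -> z * gelt O h = gelt O h * z) ->
  z * z = z -> aug z != 0 -> forall v : V, mod_act z v = v.
Proof.
move=> V_ind fh [v fv] Hz zC zz z0.
have [D Z _ _ M _] := mod_actP V.
have zh : mod_hom (@mod_act _ _ _ V z).
  apply: mod_hom_gelt => [||h Hh w]; [exact: D|exact: Z|].
  by have sh := supported_gelt O Hh; rewrite -!M // zC.
have zz' (w : V) : mod_act z (mod_act z w) = mod_act z w by rewrite -M ?zz.
have [zw|//] := indecomposable_idempotent V_ind zh zz'.
have [_ _ fa] := fh; have := fa z Hz v; rewrite zw (mod_hom0 fh) => /esym/eqP.
by rewrite mulf_eq0 (negPf z0) (negPf fv).
Qed.

Section Twist.
Variables (O : comNzRingType) (gT : finGroupType).
Local Notation R := (galg O gT).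
Local Notation R2 := (galg O (gT * opgroup gT)%type).
Local Notation gelt := (gelt O).

(* the isomorphism g (x) h |-> (g, h^-1) from OX (x) (OX)^op to O(X * X) *)
Definition untwist (z : R2) : galg O (gT * gT)%type := [ffun g => z (g.1, g.2^-1%g)].

Lemma untwistD z w : untwist (z + w) = untwist z + untwist w.
Proof. by apply/ffunP => g; rewrite !ffunE. Qed.

Lemma untwistZ c z : untwist (c *: z) = c *: untwist z.
Proof. by apply/ffunP => g; rewrite !ffunE. Qed.

Lemma untwistM z w : untwist (z * w) = untwist z * untwist w.
Proof.
apply/ffunP => -[g h]; rewrite ffunE !galgME /=.
pose tw (x : gT * gT) : (gT * opgroup gT)%type := (x.1, x.2^-1%g).
pose tw' (x : (gT * opgroup gT)%type) : gT * gT := (x.1, (x.2 : gT)^-1%g).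
have twK : cancel tw tw' by case=> x y; rewrite /tw /tw' /= invgK.
have tw'K : cancel tw' tw by case=> x y; rewrite /tw /tw' /= invgK.
rewrite (reindex tw) /=; last by apply: onW_bij; exists tw'.
apply: eq_bigr => -[x y] _; rewrite !ffunE /=; congr (_ * w (_, _)).
by rewrite [RHS]invMg invgK; congr mulg; apply: invgK.
Qed.

Lemma untwist_gelt (g h : gT) : untwist (tens (gelt g) (gelt h^-1)) = gelt (g, h).
Proof.
apply/ffunP => -[x y]; rewrite !ffunE /= -natrM mulnb xpair_eqE.
by rewrite (inj_eq invg_inj).
Qed.

Lemma aug_untwist (x y : R) : aug (untwist (tens x y)) = aug x * aug y.
Proof.
pose F (g h : gT) := x g * y h^-1%g.
rewrite [LHS](eq_bigr (fun p => F p.1 p.2)) => [|[g h] _]; last by rewrite !ffunE.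
rewrite -(pair_bigA _ F) mulr_suml; apply: eq_bigr => g _ /=.
by rewrite mulr_sumr [RHS](reindex_inj invg_inj).
Qed.

Lemma tensZr c (x y : R) : tens x (c *: y) = c *: tens x y.
Proof. by apply/ffunP => g; rewrite !ffunE; apply: mulrCA. Qed.

Lemma tensDr (x y z : R) : tens x (y + z) = tens x y + tens x z.
Proof. by apply/ffunP => g; rewrite !ffunE mulrDr. Qed.

Lemma untwist_supported (A : {set gT * gT}) (A1 A2 : {set gT}) (x y : R) :
  supported A1 x -> supported A2 y ->
  (forall g h, g \in A1 -> h^-1%g \in A2 -> (g, h) \in A) ->
  supported A (untwist (tens x y)).
Proof.
move=> A1x A2y A12 [g h] Agh; rewrite !ffunE /=.
have [A1g|/A1x->] := boolP (g \in A1); last exact: mul0r.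
have [A2h|/A2y->] := boolP (h^-1%g \in A2); last exact: mulr0.
by rewrite A12 in Agh.
Qed.

End Twist.

Section PrincipalBlock.
Variables (O : idomainType) (gT : finGroupType) (G N : {group gT}) (b : galg O gT).
Hypotheses (nsNG : (N <| G)%g) (blk_b : principal_block N b).
Local Notation gelt := (gelt O).

Lemma principal_block_central h : h \in N -> b * gelt h = gelt h * b.
Proof.
by move=> Nh; case: blk_b => -[[_ + _] _ _] _; apply; apply: supported_gelt.
Qed.

(* The product of b and its conjugate is a central idempotent of augmentation
   aug b != 0, and b is primitive. *)
Lemma principal_block_absorb g : g \in G -> b * (gelt g * b * gelt g^-1) = b.
Proof.
move=> Gg; have [[[bN bC bb] b0 b_prim] b1] := blk_b.
have gK : gelt g * gelt g^-1 = 1 by rewrite geltM mulgV.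
have gVK : gelt g^-1 * gelt g = 1 by rewrite geltM mulVg.
pose c := gelt g * b * gelt g^-1.
have nNg : g \in 'N(N)%g by rewrite (subsetP (normal_norm nsNG)).
have conjP x h : (gelt g * x * gelt g^-1) h = x (h ^ g)%g.
  by rewrite mul_geltE gelt_mulE invgK.
have conjM x y : gelt g * (x * y) * gelt g^-1
    = (gelt g * x * gelt g^-1) * (gelt g * y * gelt g^-1).
  by rewrite !mulrA -[_ * gelt g^-1 * gelt g]mulrA gVK mulr1.
have cN : supported N c by move=> h Nh; rewrite conjP bN // memJ_norm.
have cc : c * c = c by rewrite -conjM bb.
have cC x : supported N x -> c * x = x * c.
  move=> Nx; pose y := gelt g^-1 * x * gelt g.
  have -> : x = gelt g * y * gelt g^-1.
    by rewrite /y !mulrA gK mul1r -mulrA gK mulr1.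
  rewrite -!conjM bC // => h Nh; rewrite /y mul_geltE gelt_mulE invgK.
  by apply: Nx; apply: contra Nh => Nh; rewrite -(memJ_norm _ (groupVr nNg)) conjgE invgK.
have aug_c : aug c = aug b by rewrite !augM !aug_gelt mul1r mulr1.
have bcI : central_idem N (b * c).
  split; first exact: supportedM.
    by move=> x Nx; rewrite -mulrA cC // mulrA bC // mulrA.
  by rewrite mulrA -[b * c * b]mulrA cC // mulrA bb -mulrA cc.
have bc0 : b * c != 0.
  apply/eqP => bc; have := augM b c.
  rewrite bc aug_c /aug big1 => [|x _]; last by rewrite ffunE.
  by move/esym/eqP; rewrite mulf_eq0 (negPf b1).
have [//||//] := b_prim _ bcI; first by rewrite -mulrA cC // mulrA bb.
by move=> bc; rewrite bc eqxx in bc0.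
Qed.

(** For [c = g b g^-1], absorption of the conjugates by [g] and by [g^-1] gives [b c = b] and
    [c b = c]; since [b] commutes with [c], they coincide. *)
Lemma principal_block_stable g : g \in G -> b * gelt g = gelt g * b.
Proof.
move=> Gg; have [[[bN bC _] _ _] _] := blk_b.
have gK : gelt g * gelt g^-1 = 1 by rewrite geltM mulgV.
have gVK : gelt g^-1 * gelt g = 1 by rewrite geltM mulVg.
have := principal_block_absorb (groupVr Gg); rewrite invgK.
move=> Db; pose c := gelt g * b * gelt g^-1.
have cN : supported N c.
  move=> h Nh; rewrite /c mul_geltE gelt_mulE invgK bN // -conjgE.
  by rewrite memJ_norm // (subsetP (normal_norm nsNG)).
have cb : c * b = c.
  transitivity (gelt g * (b * (gelt g^-1 * b * gelt g)) * gelt g^-1); last by rewrite Db.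
  by rewrite /c -!mulrA gK mulr1.
have bc : b = c by rewrite -[LHS](principal_block_absorb Gg) -/c bC.
by rewrite {1}bc /c -mulrA gVK mulr1.
Qed.
End PrincipalBlock.

(** * Graded bimodules *)

Section Span.
Variables (O : comNzRingType) (V : lmodType O) (P : V -> Prop).

Lemma span_in v : P v -> Defs.span P v.
Proof.
move=> Pv; exists [:: (1, v)]; rewrite big_seq1 scale1r; split=> // x.
by rewrite inE => /eqP->.
Qed.

Lemma span0 : Defs.span P 0.
Proof. by exists [::]; rewrite big_nil. Qed.

Lemma spanD v w : Defs.span P v -> Defs.span P w -> Defs.span P (v + w).
Proof.
move=> [s [sP ->]] [t [tP ->]]; exists (s ++ t); rewrite big_cat; split=> // x.
by rewrite mem_cat => /orP[/sP|/tP].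
Qed.

Lemma spanZ c v : Defs.span P v -> Defs.span P (c *: v).
Proof.
move=> [s [sP ->]]; exists [seq (c * x.1, x.2) | x <- s]; split=> [x /mapP[y ys ->]|].
  exact: (sP _ ys).
by rewrite big_map scaler_sumr; apply: eq_bigr => x _; rewrite scalerA.
Qed.

Lemma span_sum I (s : seq I) (Q : pred I) (F : I -> V) :
  (forall i, Q i -> Defs.span P (F i)) -> Defs.span P (\sum_(i <- s | Q i) F i).
Proof. by move=> PF; apply: big_ind => //; [apply: span0 | apply: spanD]. Qed.

Lemma span_ind (S : V -> Prop) :
  S 0 -> (forall v w, S v -> S w -> S (v + w)) ->
  (forall c v, S v -> S (c *: v)) -> (forall v, P v -> S v) ->
  forall v, Defs.span P v -> S v.
Proof.
move=> S0 SD SZ SP v [s [sP ->]]; rewrite big_seq; apply: big_ind => // x /sP.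
by move=> /SP; apply: SZ.
Qed.
End Span.

Section Components.
Variables (O : comNzRingType) (gT : finGroupType) (G N : {group gT}).
Local Notation R := (galg O gT).
Local Notation gelt := (gelt O).
Hypothesis nsNG : (N <| G)%g.
Variable b : R.
Hypotheses (bN : supported N b) (bb : b * b = b).

Let coset_morph : {in G &, {morph coset N : x y / (x * y)%g}}.
Proof.
have nNG := subsetP (normal_norm nsNG).
by move=> x y /nNG nx /nNG ny; rewrite morphM.
Qed.

Definition cset (x : coset_of N) : {set gT} := [set g in G | coset N g == x].

Lemma cset_mul x y (a d : R) : supported (cset x) a -> supported (cset y) d ->
  supported (cset (x * y)%g) (a * d).
Proof.
move=> ax dy g xyg; rewrite galgME big1 // => h _.
have [xh|/ax->] := boolP (h \in cset x); last exact: mul0r.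
rewrite [d _]dy ?mulr0 //; apply: contra xyg; move: xh; rewrite !inE.
move=> /andP[Gh /eqP <-] /andP[Ghg /eqP <-].
have -> : g = (h * (h^-1 * g))%g by rewrite mulKVg.
by rewrite groupM //= coset_morph // mulKg.
Qed.

Lemma cset1 : cset 1%g = N.
Proof.
apply/setP => g; rewrite inE; apply/andP/idP => [[Gg /eqP]|Ng].
  by apply: coset_idr; apply: (subsetP (normal_norm nsNG)).
by rewrite (subsetP (normal_sub nsNG)) // coset_id.
Qed.

Lemma corner_supp (H : {group gT}) (a : R) : N \subset H ->
  corner b H a <-> supported H a /\ b * a = a.
Proof.
move=> sNH; split=> [[y Hy ->]|[Ha ba]]; last by exists a; rewrite ?ba.
by rewrite mulrA bb; split=> //; apply: supportedM => //; apply: supportedS bN.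
Qed.

Lemma componentP x (a : R) :
  component b G x a <-> supported (cset x) a /\ b * a = a.
Proof.
split=> [[y xy ->]|[xa ba]]; last by exists a; rewrite ?ba.
rewrite mulrA bb; split=> //; rewrite -[x]mul1g.
by apply: cset_mul => //; rewrite cset1.
Qed.

Definition cut x (a : R) : R := [ffun g => if g \in cset x then a g else 0].

Lemma cut_supp x a : supported (cset x) (cut x a).
Proof. by move=> g /negPf xg; rewrite ffunE xg. Qed.

Lemma cutD x a d : cut x (a + d) = cut x a + cut x d.
Proof. by apply/ffunP => g; rewrite !ffunE; case: ifP; rewrite ?addr0. Qed.

Lemma cutZ x c a : cut x (c *: a) = c *: cut x a.
Proof. by apply/ffunP => g; rewrite !ffunE; case: ifP; rewrite ?scaler0. Qed.

Lemma cut_id x a : supported (cset x) a -> cut x a = a.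
Proof. by move=> xa; apply/ffunP => g; rewrite ffunE; case: ifPn => // /xa. Qed.

Lemma cut_neq x y a : x != y -> supported (cset x) a -> cut y a = 0.
Proof.
move=> xy xa; apply/ffunP => g; rewrite !ffunE; case: ifP => // /[!inE] /andP[_ /eqP gy].
by apply: xa; rewrite inE gy eq_sym (negPf xy) andbF.
Qed.

Lemma cut_sum a : supported G a -> \sum_(x in (G / N)%g) cut x a = a.
Proof.
move=> Ga; apply/ffunP => g; rewrite sum_ffunE.
have [Gg|Gg] := boolP (g \in G); last first.
  by rewrite Ga // big1 // => x _; rewrite ffunE inE (negPf Gg).
rewrite (bigD1 (coset N g)) ?mem_quotient //= big1 => [|x /andP[_ /negPf xg]].
  by rewrite ffunE inE Gg eqxx addr0.
by rewrite ffunE inE eq_sym xg andbF.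
Qed.

Lemma cut_big z (F : coset_of N -> R) :
  cut z (\sum_(w in (G / N)%g) F w) = \sum_(w in (G / N)%g) cut z (F w).
Proof.
apply: (big_morph (cut z)) => [w v|]; first exact: cutD.
by apply/ffunP => g; rewrite !ffunE if_same.
Qed.

(** For homogeneous [a], only the [y]-component of [d] contributes to degree [x * y]. *)
Lemma cut_mull x y (a d : R) : supported G d -> supported (cset x) a ->
  x \in (G / N)%g -> y \in (G / N)%g -> a * cut y d = cut (x * y)%g (a * d).
Proof.
move=> Gd xa Gx Gy; rewrite -{2}(cut_sum Gd) mulr_sumr.
rewrite cut_big (bigD1 y) //= [cut _ (a * _)]cut_id.
  2: exact: cset_mul xa (@cut_supp _ _).
rewrite big1 ?addr0 // => z /andP[_ zy].
apply: (cut_neq (x := (x * z)%g)); last exact (cset_mul xa (@cut_supp _ _)).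
by rewrite (inj_eq (mulgI x)).
Qed.

Lemma cut_mulr x y (a d : R) : supported G d -> supported (cset x) a ->
  x \in (G / N)%g -> y \in (G / N)%g -> cut y d * a = cut (y * x)%g (d * a).
Proof.
move=> Gd xa Gx Gy; rewrite -{2}(cut_sum Gd) mulr_suml.
rewrite cut_big (bigD1 y) //= [cut _ (_ * a)]cut_id.
  2: exact: cset_mul (@cut_supp _ _) xa.
rewrite big1 ?addr0 // => z /andP[_ zy].
apply: (cut_neq (x := (z * x)%g)); last exact: cset_mul (@cut_supp _ _) xa.
by rewrite (inj_eq (mulIg x)).
Qed.

Lemma component_cut x a : x \in (G / N)%g -> corner b G a -> component b G x (cut x a).
Proof.
move=> Gx /corner_supp[|Ga ba]; first exact: normal_sub.
apply/componentP; split; first exact: cut_supp.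
by rewrite (cut_mull (x := 1%g)) ?group1 ?mul1g ?ba // cset1.
Qed.

Lemma component_corner (x : coset_of N) a : component b G x a -> corner b G a.
Proof.
case=> y xy ->; exists y => //; apply: supportedS xy.
by apply/subsetP => g /[!inE] /andP[].
Qed.

(* The x^-1-component of v is also a right inverse of u. *)
Lemma component_inv (x : coset_of N) u v :
  x \in (G / N)%g -> (forall a, corner b G a -> a * b = a) ->
  component b G x u -> corner b G v -> u * v = b -> v * u = b ->
  component b G x^-1%g v.
Proof.
move=> Gx rb xu Av uv vu; have [xs _] := (componentP x u).1 xu.
have sNG := normal_sub nsNG.
have [Gv bv] := (corner_supp v sNG).1 Av.
have Gx' : (x^-1)%g \in (G / N)%g by rewrite groupV.
have uv' : u * cut x^-1%g v = b.
  by rewrite (cut_mull (x := x)) // mulgV uv cut_id // cset1.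
have bv' : b * cut x^-1%g v = cut x^-1%g v.
  by have /componentP[] := component_cut Gx' Av.
rewrite (_ : v = cut x^-1%g v); first exact: component_cut.
by rewrite -{1}(rb v) // -[in LHS]uv' mulrA vu bv'.
Qed.

End Components.

(** * The diagonal algebra acting on a [K]-module, and the induced bimodule *)

Section DeltaModule.
Variables (O : comNzRingType) (gT : finGroupType) (G G' N : {group gT}).
Variable K : {group gT * gT}.
Local Notation R := (galg O gT).
Local Notation gelt := (gelt O).
Hypotheses (nsNG : (N <| G)%g) (sG'G : G' \subset G)
  (defK : K = [set x in setX G G' | coset N x.1 == coset N x.2] :> {set gT * gT}).
Variables (b b' : R).
Hypotheses (bN : supported N b) (bb : b * b = b)
  (bG : forall g, g \in G -> b * gelt g = gelt g * b)
  (b'N : supported (G' :&: N) b').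
Variable D : module (galgO O K).
Local Notation act z := (@mod_act _ _ _ D (untwist z)).
Hypotheses (act_b : forall d, act (tens b 1) d = d)
  (act_b' : forall d, act (tens 1 b') d = d).

Let sNG := normal_sub nsNG.
Let nNG := subsetP (normal_norm nsNG).

Let coset_morph : {in G &, {morph coset N : x y / (x * y)%g}}.
Proof. by move=> x y /nNG nx /nNG ny; rewrite morphM. Qed.

Let memK g h : ((g, h) \in K) = [&& g \in G, h \in G' & coset N g == coset N h].
Proof. by rewrite defK !inE andbA. Qed.

(** The twist inverts the second coordinate, which turns inverse degrees into the equality of cosets
    that defines [K]. *)
Lemma untwist_fibre (x y : coset_of N) (a a' : R) : (x * y = 1)%g ->
  supported (cset G x) a -> supported (cset G' y) a' -> supported K (untwist (tens a a')).
Proof.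
move=> xy xa ya'; apply: (untwist_supported xa ya') => g h.
rewrite !inE memK groupV => /andP[-> /eqP Dx] /andP[G'h /eqP Dy].
rewrite G'h Dx; apply/eqP; apply: (mulIg y); rewrite xy -Dy.
have Gh := subsetP sG'G h G'h.
by rewrite -coset_morph ?groupV // mulgV coset_id.
Qed.

(** [G'] need not contain [N], so [componentP] does not apply to it; what serves instead is that
    [b'] is supported on [G' :&: N], in degree 1. *)
Let compN' (x : coset_of N) (a : R) : component b' G' x a -> supported (cset G' x) a.
Proof.
case=> y xy ->; move=> g xg; rewrite galgME big1 // => h _.
have [|/b'N->] := boolP (h \in G' :&: N); last exact: mul0r.
case/setIP=> G'h Nh; rewrite xy ?mulr0 //; apply: contra xg; rewrite !inE.
case/andP=> G'hg /eqP <-; have -> : g = (h * (h^-1 * g))%g by rewrite mulKVg.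
rewrite groupM //= coset_morph ?(subsetP sG'G) // coset_id // mul1g.
by rewrite mulKVg.
Qed.

Lemma cset1I : cset G' (1%g : coset_of N) = G' :&: N.
Proof.
apply/setP => g; rewrite !inE; apply: andb_id2l => /(subsetP sG'G) Gg.
by apply/eqP/idP => [/(coset_idr (nNG Gg))|/coset_id].
Qed.

Lemma supp_l (r : R) : supported N r -> supported K (untwist (tens r 1)).
Proof.
move=> Nr; apply: (@untwist_fibre 1%g 1%g); rewrite ?mulg1 ?(cset1 nsNG) //.
by rewrite cset1I; apply: (@supported1 _ _ (G' :&: N)%G).
Qed.

Lemma supp_1b' : supported K (untwist (tens 1 b')).
Proof.
apply: (@untwist_fibre 1%g 1%g); rewrite ?mulg1 ?(cset1 nsNG) ?cset1I //.
exact: (@supported1 _ _ N).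
Qed.

Lemma untwist_delta z : delta_alg b b' G G' N z -> supported K (untwist z).
Proof.
move=> [s [sP ->]]; rewrite big_seq.
have untwist0 : untwist 0 = 0 :> galg O (gT * gT)%type by apply/ffunP => g; rewrite !ffunE.
apply: (big_ind (fun z => supported K (untwist z))).
- by move=> g _; rewrite untwist0 ffunE.
- by move=> z1 z2 s1 s2; rewrite untwistD; apply: supportedD.
move=> i /sP [x [a [a' [Gx xa xa' ->]]]]; rewrite untwistZ; apply: supportedZ.
apply: untwist_fibre (compN' xa'); first exact: mulgV.
by have /componentP[] := xa.
Qed.

Definition delta_act (z : galg O (gT * opgroup gT)%type) (d : D) : D := act z d.

Lemma delta_axioms : mod_axioms (delta_alg b b' G G' N) delta_act.
Proof.
have [aD aZ aDl aZl aM _] := mod_actP D.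
split=> [a /untwist_delta Ka d e|a /untwist_delta Ka c d|a d /untwist_delta Ka
    /untwist_delta Kd e|c a /untwist_delta Ka d|a d /untwist_delta Ka /untwist_delta Kd e|d];
  rewrite /delta_act.
- exact: aD.
- exact: aZ.
- by rewrite untwistD aDl.
- by rewrite untwistZ aZl.
- by rewrite untwistM aM.
rewrite /= (_ : tens b b' = tens b 1 * tens 1 b'); last by rewrite tensM !mulr1.
by rewrite untwistM aM ?act_b' ?act_b //; [exact: supp_l | exact: supp_1b'].
Qed.

Definition delta_mod : module (delta_alg b b' G G' N) := Module delta_axioms.

Local Notation A := (corner b G).
Local Notation B := (corner b N).
Local Notation T := (ind_delta delta_mod).
Local Notation pure := (@ind_delta_pure O gT G G' N b b' delta_mod).
Local Notation lact := (@ind_delta_lact O gT G G' N b b' delta_mod).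
Local Notation comp := (@ind_delta_comp O gT G G' N b b' delta_mod).

Let cornerP (a : R) : A a <-> supported G a /\ b * a = a := corner_supp bN bb a sNG.

Lemma cornerD a d : A a -> A d -> A (a + d).
Proof.
move=> /cornerP[Ga ba] /cornerP[Gd bd]; apply/cornerP.
by split; [apply: supportedD | rewrite mulrDr ba bd].
Qed.

Lemma cornerZ c a : A a -> A (c *: a).
Proof.
move=> /cornerP[Ga ba]; apply/cornerP.
by split; [apply: supportedZ | rewrite -scalerAr ba].
Qed.

Lemma cornerM a d : A a -> supported G d -> A (a * d).
Proof.
move=> /cornerP[Ga ba] Gd; apply/cornerP.
by split; [apply: supportedM | rewrite mulrA ba].
Qed.

Lemma cornerB r : B r -> supported N r.
Proof. by move=> /(corner_supp bN bb _ (subxx N))[]. Qed.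

Lemma corner_mulB a r : A a -> B r -> A (a * r).
Proof. by move=> Aa /cornerB Nr; apply: cornerM => //; apply: supportedS Nr. Qed.

Lemma corner_mul a d : A a -> A d -> A (a * d).
Proof. by move=> Aa /cornerP[Gd _]; apply: cornerM. Qed.

Lemma b_central a : supported G a -> b * a = a * b.
Proof.
move=> Ga; rewrite (galg_gelt_sub Ga) mulr_sumr mulr_suml.
by apply: eq_bigr => g Gg; rewrite -scalerAr -scalerAl bG.
Qed.

Lemma corner_mulb a : A a -> a * b = a.
Proof. by case/cornerP=> Ga ba; rewrite -b_central. Qed.

Lemma corner_one a : A a -> b * a = a.
Proof. by case/cornerP. Qed.

Lemma corner_b : A b.
Proof. by apply/cornerP; split=> //; apply: supportedS bN. Qed.

Let T_bal := tensor_balanced (fun r (d : delta_mod) => mod_act (tens r b') d)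
  cornerD cornerZ corner_mulB.

Lemma pure_sum I (s : seq I) (P : pred I) (F : I -> R) d : (forall i, P i -> A (F i)) ->
  pure (\sum_(i <- s | P i) F i) d = \sum_(i <- s | P i) pure (F i) d.
Proof.
move=> AF; have A0 : A 0 by rewrite -(scale0r b); apply/cornerZ/corner_b.
suff [] : A (\sum_(i <- s | P i) F i) /\
    pure (\sum_(i <- s | P i) F i) d = \sum_(i <- s | P i) pure (F i) d by [].
apply: (big_rec2 (fun x y => A x /\ pure x d = y)).
  by split=> //; rewrite -(scale0r b) [LHS](balZl T_bal) ?scale0r //; apply: corner_b.
move=> i x y /AF AFi [Ax <-]; split; first exact: cornerD.
exact: (balDl T_bal).
Qed.

Lemma lact_axioms : mod_axioms A lact.
Proof.
apply: tact_axioms.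
- exact: cornerD.
- exact: cornerZ.
- exact: corner_mulB.
- exact: corner_mul.
- exact: corner_one.
- exact: cornerD.
- exact: cornerZ.
- exact: corner_mul.
- exact: corner_b.
Qed.

Lemma lact_pure a e d : A a -> A e -> lact a (pure e d) = pure (a * e) d.
Proof.
move=> Aa Ae; apply: (@tact_pure _ _ _ _ _ _ (corner b G)) => //.
- exact: cornerD.
- exact: cornerZ.
- exact: corner_mulB.
- exact: corner_mul.
Qed.

Local Notation dact g := (@mod_act _ _ _ D (gelt (g, g))).

Lemma memK_diag g : g \in G' -> (g, g) \in K.
Proof. by move=> G'g; rewrite memK G'g eqxx (subsetP sG'G). Qed.

Lemma actM_sup z w d : supported K (untwist z) -> supported K (untwist w) ->
  act (z * w) d = act z (act w d).
Proof. by have [_ _ _ _ aM _] := mod_actP D => Kz Kw; rewrite untwistM aM. Qed.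

Lemma act_gelt g h d : act (tens (gelt g) (gelt h^-1)) d = mod_act (gelt (g, h)) d.
Proof. by rewrite untwist_gelt. Qed.

Lemma supported_cset (H : {group gT}) g :
  g \in H -> supported (cset H (coset N g)) (gelt g).
Proof.
by move=> Hg h hH; rewrite ffunE; case: eqP => // Dh; rewrite inE Dh Hg eqxx in hH.
Qed.

(** In the opposite algebra the right factor [b'] of [a' * b'] acts last, and it acts as the
    identity. *)
Lemma act_tens_b' (x y : coset_of N) a a' d : (x * y = 1)%g ->
  supported (cset G x) a -> supported (cset G' y) a' ->
  act (tens a (a' * b')) d = act (tens a a') d.
Proof.
move=> xy xa ya'; rewrite -[a in LHS]mul1r -tensM actM_sup ?act_b' //.
  exact: supp_1b'.
exact: untwist_fibre xy xa ya'.
Qed.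

Lemma supp_gelt g h : (g, h) \in K -> supported K (untwist (tens (gelt g) (gelt h^-1))).
Proof. by move=> Kgh; rewrite untwist_gelt; apply: supported_gelt. Qed.

Lemma act_l_b' (r : R) d : supported N r -> act (tens r b') d = act (tens r 1) d.
Proof.
move=> Nr; rewrite -[b' in LHS]mul1r; apply: (@act_tens_b' 1%g 1%g).
- by rewrite mulg1.
- by rewrite cset1.
- by rewrite cset1I; apply: (@supported1 _ _ (G' :&: N)%G).
Qed.

Lemma act_l_dact g (r s : R) d : g \in G' -> supported N r -> supported N s ->
  s * gelt g = gelt g * r ->
  act (tens s b') (dact g d) = dact g (act (tens r b') d).
Proof.
move=> G'g Nr Ns sg; rewrite !act_l_b' // -!act_gelt -!actM_sup ?tensM ?mul1r ?mulr1 ?sg //;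
  by [exact: supp_l | apply/supp_gelt/memK_diag].
Qed.

Definition rtrans_fun g a (d : delta_mod) : T := pure (a * gelt g) (dact g^-1%g d).

(** Moving [r] past [g] conjugates it into [s = g^-1 r g], again in [B], and the diagonal action of
    [g^-1] on [D] matches this conjugation. *)
Lemma rtrans_balanced g : g \in G' ->
  balanced A B (fun r (d : delta_mod) => mod_act (tens r b') d) (rtrans_fun g).
Proof.
move=> G'g; have Gg := subsetP sG'G g G'g; have sg := supported_gelt O Gg.
have [aD aZ _ _ _ _] := mod_actP D.
have Kg := memK_diag (groupVr G'g); have sK := supported_gelt O Kg.
rewrite /rtrans_fun; split=> [a e Aa Ae d|a Aa d e|c a Aa d|a Aa c d|a r Aa Br d].
- by rewrite mulrDl; apply: (balDl T_bal); apply: cornerM.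
- by rewrite aD //; apply: (balDr T_bal); apply: cornerM.
- by rewrite -scalerAl; apply: (balZl T_bal); apply: cornerM.
- by rewrite aZ //; apply: (balZr T_bal); apply: cornerM.
have Nr := cornerB Br; pose s := gelt g^-1 * r * gelt g.
have gK : gelt g * gelt g^-1 = 1 by rewrite geltM mulgV.
have -> : a * r * gelt g = a * gelt g * s.
  by rewrite /s !mulrA -[a * gelt g * _]mulrA gK mulr1.
have Ns : supported N s.
  move=> h Nh; rewrite /s mul_geltE gelt_mulE invgK; apply: Nr.
  by apply: contra Nh => Nh; rewrite -(memJ_norm _ (groupVr (nNG Gg))) conjgE invgK.
have Bs : B s.
  apply/(corner_supp bN bb _ (subxx N)); split=> //.
  rewrite /s !mulrA bG ?groupV // -[_ * b * r]mulrA.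
  by have [_ ->] := (corner_supp bN bb r (subxx N)).1 Br.
rewrite [LHS](balM T_bal) //; last exact: cornerM.
congr (pure _ _); rewrite /= /delta_act.
apply: act_l_dact; rewrite ?groupV //.
by rewrite /s -mulrA gK mulr1.
Qed.

Definition rtrans g : T -> T := tlift (rtrans_fun g).

Lemma rtrans_pure g a d : g \in G' -> A a ->
  rtrans g (pure a d) = pure (a * gelt g) (dact g^-1%g d).
Proof.
move=> G'g Aa; rewrite /rtrans tlift_cls ?feval_pure //.
exact: rtrans_balanced.
Qed.

Lemma rtransD g s t : g \in G' -> rtrans g (s + t) = rtrans g s + rtrans g t.
Proof. by move=> G'g; apply: tliftD; apply: rtrans_balanced. Qed.

Lemma rtransZ g c t : g \in G' -> rtrans g (c *: t) = c *: rtrans g t.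
Proof. by move=> G'g; apply: tliftZ; apply: rtrans_balanced. Qed.

Lemma rtrans0 g : g \in G' -> rtrans g 0 = 0.
Proof. by move=> G'g; rewrite -(scale0r 0) rtransZ // !scale0r. Qed.

Lemma rtrans_sum g I (s : seq I) (P : pred I) (F : I -> T) : g \in G' ->
  rtrans g (\sum_(i <- s | P i) F i) = \sum_(i <- s | P i) rtrans g (F i).
Proof.
move=> G'g; apply: (big_morph (rtrans g)) => [t u|]; first exact: rtransD.
exact: rtrans0.
Qed.

Lemma ind_delta_ind (P : T -> Prop) : P 0 -> (forall s t, P s -> P t -> P (s + t)) ->
  (forall a d, A a -> P (pure a d)) -> forall t, P t.
Proof. exact: tensor_ind. Qed.

Lemma rtransM g h t : g \in G' -> h \in G' -> rtrans (g * h) t = rtrans h (rtrans g t).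
Proof.
move=> G'g G'h; have Gg := supported_gelt O (subsetP sG'G g G'g).
elim/ind_delta_ind: t => [|s t IHs IHt|a d Aa]; first by rewrite !rtrans0 ?groupM.
  by rewrite !rtransD ?groupM // IHs IHt.
rewrite !rtrans_pure ?groupM //; last exact: cornerM.
rewrite -geltM mulrA -mod_act_geltM ?memK_diag ?groupV //.
by rewrite invMg.
Qed.

Let lactD a s t : A a -> lact a (s + t) = lact a s + lact a t.
Proof. by have [lD _ _ _ _ _] := lact_axioms; move=> Aa; apply: lD. Qed.

Let lactZ a c t : A a -> lact a (c *: t) = c *: lact a t.
Proof. by have [_ lZ _ _ _ _] := lact_axioms; move=> Aa; apply: lZ. Qed.

Let lact0 a : A a -> lact a 0 = 0.
Proof. by move=> Aa; rewrite -(scale0r 0) lactZ // !scale0r. Qed.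

Lemma rtrans_lact g a t : g \in G' -> A a -> rtrans g (lact a t) = lact a (rtrans g t).
Proof.
move=> G'g Aa; have Gg := supported_gelt O (subsetP sG'G g G'g).
elim/ind_delta_ind: t => [|s t IHs IHt|e d Ae]; first by rewrite lact0 // rtrans0 // lact0.
  by rewrite lactD // !rtransD // lactD // IHs IHt.
rewrite lact_pure // !rtrans_pure //; last exact: corner_mul.
by rewrite lact_pure ?mulrA //; apply: cornerM.
Qed.

(** Extending linearly from group elements avoids choosing an invertible homogeneous [u];
    [ract_spec] recovers the formula for every such [u]. *)
Definition ract (t : T) (a : R) : T := \sum_(g in G') a g *: rtrans g t.

Lemma ractDl t s a : ract (t + s) a = ract t a + ract s a.
Proof.
by rewrite -big_split; apply: eq_bigr => g G'g; rewrite rtransD // scalerDr.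
Qed.

Lemma ractZl t a (c : O) : ract (c *: t) a = c *: ract t a.
Proof.
rewrite scaler_sumr; apply: eq_bigr => g G'g.
by rewrite rtransZ // !scalerA mulrC.
Qed.

Lemma ractDr t a d : ract t (a + d) = ract t a + ract t d.
Proof. by rewrite -big_split; apply: eq_bigr => g _; rewrite ffunE scalerDl. Qed.

Lemma ractZr t a (c : O) : ract t (c *: a) = c *: ract t a.
Proof. by rewrite scaler_sumr; apply: eq_bigr => g _; rewrite ffunE scalerA. Qed.

Lemma ractM t a d : supported G' a -> ract t (a * d) = ract (ract t a) d.
Proof.
move=> G'a; rewrite /ract.
transitivity (\sum_(h in G') \sum_(g in G') (a h * d g) *: rtrans (h * g) t).
  transitivity (\sum_(g in G') \sum_(h in G') (a h * d (h^-1 * g)%g) *: rtrans g t).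
    apply: eq_bigr => g G'g; rewrite galgME scaler_suml (bigID (mem G')) /=.
    by rewrite [X in _ + X]big1 ?addr0 // => h /G'a ->; rewrite mul0r scale0r.
  rewrite exchange_big; apply: eq_bigr => h G'h /=.
  rewrite (reindex_inj (mulgI h)) /=; apply: eq_big => [g|g _]; first by rewrite groupMl.
  by rewrite mulKg.
rewrite exchange_big; apply: eq_bigr => g G'g /=.
rewrite rtrans_sum // scaler_sumr; apply: eq_bigr => h G'h.
by rewrite rtransZ // rtransM // scalerA mulrC.
Qed.

Lemma ract_gelt t g : g \in G' -> ract t (gelt g) = rtrans g t.
Proof.
move=> G'g; rewrite /ract (bigD1 g) //= big1 => [|h /andP[_ /negPf hg]].
  by rewrite ffunE eqxx scale1r addr0.
by rewrite ffunE hg scale0r.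
Qed.

Lemma ract_lact a t d : A a -> ract (lact a t) d = lact a (ract t d).
Proof.
move=> Aa; rewrite /ract (big_morph (lact a) (fun s t => lactD s t Aa) (lact0 Aa)).
by apply: eq_bigr => g G'g; rewrite lactZ // rtrans_lact.
Qed.

Lemma cset_supp (H : {group gT}) (x : coset_of N) (a : R) :
  supported (cset H x) a -> supported H a.
Proof. by apply: supportedS; apply/subsetP => g /[!inE] /andP[]. Qed.

Lemma act_tens_sum (x y : coset_of N) v a' d : (x * y = 1)%g ->
  supported (cset G x) v -> supported (cset G' y) a' ->
  act (tens v a') d = \sum_(g in cset G' y) a' g *: act (tens v (gelt g)) d.
Proof.
move=> xy xv ya'; have [_ _ aDl aZl _ _] := mod_actP D.
rewrite {1}(galg_gelt_sub ya').
have gelt_y g : g \in cset G' y -> supported (cset G' y) (gelt g).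
  by rewrite inE => /andP[G'g /eqP <-]; apply: supported_cset.
have act0 : act (tens v 0) d = 0.
  by rewrite -[X in tens v X](scale0r 0) tensZr untwistZ aZl ?scale0r //;
    by apply: (untwist_fibre xy xv) => g _; rewrite ffunE.
have [] : supported (cset G' y) (\sum_(g in cset G' y) a' g *: gelt g) /\
    act (tens v (\sum_(g in cset G' y) a' g *: gelt g)) d
    = \sum_(g in cset G' y) a' g *: act (tens v (gelt g)) d; last by [].
apply: (big_rec2 (fun s t => supported (cset G' y) s /\ act (tens v s) d = t)).
  by split=> // g _; rewrite ffunE.
move=> g s t /gelt_y yg [ys <-]; split.
  by apply: supportedD => //; apply: supportedZ.
rewrite tensDr untwistD tensZr untwistZ aDl ?aZl //.
- exact: (untwist_fibre xy xv yg).
- by apply: supportedZ; apply: (untwist_fibre xy xv yg).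
- exact: (untwist_fibre xy xv ys).
Qed.

(* For g in the support of a', the element v g lies in B and moves across the
   tensor sign. *)
Lemma ract_pure (x y : coset_of N) a v a' d : (x * y = 1)%g -> A a ->
  supported (cset G x) v -> b * v = v -> supported (cset G' y) a' ->
  ract (pure (a * v) d) a' = pure a (act (tens v a') d).
Proof.
move=> xy Aa xv bv ya'; have Gv := cset_supp xv.
have Aav := cornerM Aa Gv.
have [aD aZ _ _ _ _] := mod_actP D.
rewrite (act_tens_sum d xy xv ya').
have pure0 : pure a 0 = 0 by rewrite -(scale0r 0) [LHS](balZr T_bal) // !scale0r.
rewrite (big_morph (pure a) (balDr T_bal Aa) pure0).
rewrite /ract (bigID (mem (cset G' y))) /= [X in _ + X]big1 ?addr0; last first.
  by move=> g /andP[_ /ya' ->]; rewrite scale0r.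
apply: eq_big => [g|g /andP[G'g yg]]; first by rewrite !inE; case: (g \in G').
have Gg := subsetP sG'G g G'g.
have Dy : coset N g = y by move: yg; rewrite inE => /andP[_ /eqP].
rewrite [RHS](balZr T_bal) // rtrans_pure // -mulrA; congr (_ *: _).
have Nvg : supported N (v * gelt g).
  rewrite -(cset1 nsNG) -xy -Dy; apply: cset_mul xv _ => //.
  exact: supported_cset.
have Bvg : B (v * gelt g).
  by apply/(corner_supp bN bb _ (subxx N)); rewrite mulrA bv.
rewrite [LHS](balM T_bal) //; congr (pure a _); rewrite /= /delta_act.
have gg : supported (cset G' y) (gelt g) by rewrite -Dy; apply: supported_cset.
have G'gV := groupVr G'g.
rewrite -act_gelt -actM_sup; last 2 first.
- by apply: (@untwist_fibre 1%g 1%g); rewrite ?mulg1 ?(cset1 nsNG) ?cset1I.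
- exact/supp_gelt/memK_diag.
rewrite invgK tensM -mulrA geltM mulgV mulr1.
exact: (act_tens_b' _ xy).
Qed.

Lemma ract_b' t : ract t b' = t.
Proof.
elim/ind_delta_ind: t => [|s t IHs IHt|a d Aa].
- by rewrite -{1}(scale0r 0) ractZl scale0r.
- by rewrite ractDl IHs IHt.
rewrite -{1}(corner_mulb Aa) (@ract_pure 1%g 1%g) ?mulg1 ?(cset1 nsNG) ?cset1I //.
by have [_ _ _ _ _ a1] := delta_axioms; congr (pure a _); apply: a1.
Qed.

Lemma ract_spec : @ind_delta_ractP O gT G G' N b b' delta_mod ract.
Proof.
move=> h u v a' Gh hu Av uv vu ha' a d Aa.
have Au := component_corner hu.
have hv' := component_inv nsNG bN bb Gh corner_mulb hu Av uv vu.
have [hv bv] := (componentP nsNG bN bb _ _).1 hv'.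
(* Inserting [b = u * v] exposes a factor [v] of degree inverse to that of [a'], as [ract_pure]
   requires. *)
have -> : pure a d = pure (a * u * v) d by rewrite -mulrA uv corner_mulb.
exact: (ract_pure d (mulVg h) (corner_mul Aa Au) hv bv (compN' ha')).
Qed.

Lemma act_bimodule : is_bimodule A (corner b' G') lact ract.
Proof.
have b'G' (a : R) : corner b' G' a -> supported G' a.
  case=> y G'y ->; apply: supportedM => //.
  by apply: supportedS b'N; apply: subsetIl.
split.
- exact: lact_axioms.
- split=> *; [exact: ractDl | exact: ractZl | exact: ractDr | exact: ractZr].
- by move=> t a d /b'G' G'a _; apply: ractM.
- exact: ract_b'.
- by move=> a t d Aa _; apply: ract_lact.
Qed.

Definition cut_fun (x : coset_of N) a (d : delta_mod) : T := pure (cut G x a) d.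

Let cutP (x : coset_of N) a : x \in (G / N)%g -> A a -> A (cut G x a).
Proof.
move=> Gx Aa; apply: (@component_corner _ _ _ _ _ x).
exact: component_cut.
Qed.

(** [B] lies in degree 1, so right multiplication by [B] commutes with cutting to a degree. *)
Lemma cut_balanced (x : coset_of N) : x \in (G / N)%g ->
  balanced A B (fun r (d : delta_mod) => mod_act (tens r b') d) (cut_fun x).
Proof.
move=> Gx; rewrite /cut_fun; split=> [a e Aa Ae d|a Aa d e|c a Aa d|a Aa c d|a r Aa Br d].
- by rewrite cutD; apply: (balDl T_bal); apply: cutP.
- by apply: (balDr T_bal); apply: cutP.
- by rewrite cutZ; apply: (balZl T_bal); apply: cutP.
- by apply: (balZr T_bal); apply: cutP.
have Nr := cornerB Br; have [Ga _] := (cornerP a).1 Aa.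
rewrite -[x]mulg1 -(cut_mulr nsNG) ?cset1 //.
by rewrite mulg1; apply: (balM T_bal) => //; apply: cutP.
Qed.

Definition tcut (x : coset_of N) : T -> T := tlift (cut_fun x).

Lemma tcut_pure (x : coset_of N) a d : x \in (G / N)%g -> A a ->
  tcut x (pure a d) = pure (cut G x a) d.
Proof. by move=> Gx Aa; rewrite /tcut tlift_cls ?feval_pure //; apply: cut_balanced. Qed.

Lemma tcutD (x : coset_of N) s t : x \in (G / N)%g -> tcut x (s + t) = tcut x s + tcut x t.
Proof. by move=> Gx; apply: tliftD; apply: cut_balanced. Qed.

Lemma tcutZ (x : coset_of N) c t : x \in (G / N)%g -> tcut x (c *: t) = c *: tcut x t.
Proof. by move=> Gx; apply: tliftZ; apply: cut_balanced. Qed.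

Lemma tcut0 (x : coset_of N) : x \in (G / N)%g -> tcut x 0 = 0.
Proof. by move=> Gx; rewrite -(scale0r 0) tcutZ // !scale0r. Qed.

Lemma tcut_comp (x y : coset_of N) t : x \in (G / N)%g -> y \in (G / N)%g ->
  comp x t -> tcut y t = if x == y then t else 0.
Proof.
move=> Gx Gy; move: t; apply: span_ind => [|s t IHs IHt|c t IHt|t [a [d [xa ->]]]].
- by rewrite tcut0 // if_same.
- by rewrite tcutD // IHs IHt; case: ifP => _; rewrite ?addr0.
- by rewrite tcutZ // IHt; case: ifP => _; rewrite ?scaler0.
have [Gxa _] := (componentP nsNG bN bb x a).1 xa.
rewrite tcut_pure //; last exact: component_corner xa.
case: eqP => [<-|/eqP xy]; first by rewrite cut_id.
rewrite (cut_neq xy Gxa) -(scale0r b) [LHS](balZl T_bal) ?scale0r //.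
exact: corner_b.
Qed.

(** The maps [tcut x] sum to the identity, which gives existence; each is the identity on its own
    component and kills the others, which gives uniqueness. *)
Lemma ind_delta_grading : is_grading (G / N)%g comp.
Proof.
have A0 : A 0 by rewrite -(scale0r b); apply/cornerZ/corner_b.
split=> [x Gx|t].
  apply: span_ind => [|||//]; [exact: span0 | exact: spanD | exact: spanZ].
have comp_tcut x u : x \in (G / N)%g -> comp x (tcut x u).
  move=> Gx; elim/ind_delta_ind: u => [|s u IHs IHu|a d Aa].
  - by rewrite tcut0 //; apply: span0.
  - by rewrite tcutD //; apply: spanD.
  - rewrite tcut_pure //; apply: span_in; exists (cut G x a), d.
    by split=> //; apply: component_cut.
have sum_tcut u : u = \sum_(x in (G / N)%g) tcut x u.
  elim/ind_delta_ind: u => [|s u {1}-> {1}->|a d Aa].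
  - by rewrite big1 // => x Gx; rewrite tcut0.
  - by rewrite -big_split; apply: eq_bigr => x Gx; rewrite tcutD.
  have [Ga _] := (cornerP a).1 Aa.
  rewrite -{1}(cut_sum N Ga) pure_sum => [|x Gx]; last exact: cutP.
  by apply: eq_bigr => x Gx; rewrite tcut_pure.
exists [ffun x => if x \in (G / N)%g then tcut x t else 0]; split.
  split=> [x Gx|x /negPf Gx|]; rewrite ?ffunE ?Gx //; first exact: comp_tcut.
  by rewrite {1}[t]sum_tcut; apply: eq_bigr => x Gx; rewrite ffunE Gx.
move=> F [Fx F0 Dt]; apply/ffunP => x; rewrite ffunE.
case: ifPn => [Gx|/F0//].
rewrite Dt (big_morph (tcut x) (fun s t => tcutD s t Gx) (tcut0 Gx)).
rewrite (bigD1 x) //= (tcut_comp Gx Gx (Fx x Gx)) eqxx big1 ?addr0 // => y /andP[Gy yx].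
by rewrite (tcut_comp Gy Gx (Fx y Gy)) (negPf yx).
Qed.

Lemma ind_delta_graded : is_graded_bimodule G G' b b' lact ract comp.
Proof.
split; [exact: act_bimodule | exact: ind_delta_grading |].
move=> g x h Gg Gx Gh a t a' ga xt ha'.
have Aa := component_corner ga.
elim/span_ind: t / xt => [|s t IHs IHt|c t IHt|t [e [d [xe ->]]]].
- by rewrite lact0 // -(scale0r 0) ractZl scale0r; apply: span0.
- by rewrite lactD // ractDl; apply: spanD.
- by rewrite lactZ // ractZl; apply: spanZ.
have Ae := component_corner xe.
have [gsa ba] := (componentP nsNG bN bb _ _).1 ga.
have [xse be] := (componentP nsNG bN bb _ _).1 xe.
rewrite lact_pure // /ract (bigID (mem (cset G' h))) /= [X in _ + X]big1 ?addr0; last first.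
  by move=> k /andP[_ /(compN' ha') ->]; rewrite scale0r.
apply: span_sum => k /andP[G'k]; rewrite inE => /andP[_ /eqP <-].
apply: spanZ; rewrite rtrans_pure //; last exact: corner_mul.
apply: span_in; exists (a * e * gelt k), (dact k^-1%g d); split=> //.
apply/(componentP nsNG bN bb); split; last by rewrite !mulrA ba.
apply: cset_mul => //; first exact: cset_mul.
exact: supported_cset (subsetP sG'G k G'k).
Qed.

Hypotheses (sCG' : 'C_G(N)%g \subset G')
  (act_C : forall c d, c \in 'C_G(N)%g -> dact c d = d).

(** On [a (x) d] with [a] of degree gN, the pair [(c^-1, c^-1)] fixes [d], and [a c = (g c g^-1) a]
    since [a] is supported on gN and [c] commutes with [N]. *)
Lemma ind_delta_over : over_centralizer G b b' lact ract comp.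
Proof.
move=> g c t Gg Cc; have /setIP[Gc cN] := Cc; have G'c := subsetP sCG' c Cc.
have sx : supported G (gelt (g * c * g^-1)%g).
  by apply: supported_gelt; rewrite !groupM ?groupV.
have Ax : A (b * gelt (g * c * g^-1)%g) by apply: cornerM => //; apply: corner_b.
rewrite ractM ?ract_b' ?ract_gelt //; last exact: supportedS (subsetIl _ _) b'N.
move: t; apply: span_ind => [|s t IHs IHt|e t IHt|t [a [d [ga ->]]]].
- by rewrite rtrans0 // lact0.
- by rewrite rtransD // lactD // IHs IHt.
- by rewrite rtransZ // lactZ // IHt.
have Aa := component_corner ga; have [gsa ba] := (componentP nsNG bN bb _ _).1 ga.
rewrite rtrans_pure // act_C ?groupV // lact_pure //; congr (pure _ d).
rewrite b_central // -mulrA ba; apply/ffunP => h; rewrite mul_geltE gelt_mulE.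
have cC n : n \in N -> (c * n = n * c)%g by apply: (centP cN).
have memg z : z \in cset G (coset N g) -> exists2 n, n \in N & z = (g * n)%g.
  rewrite inE => /andP[Gz /eqP zg]; exists (g^-1 * z)%g; last by rewrite mulKVg.
  apply: coset_idr; first by rewrite nNG ?groupM ?groupV.
  by rewrite coset_morph ?groupV // zg -coset_morph ?groupV // mulVg coset_id.
have gnc n : n \in N -> (g * n * c = g * c * g^-1 * (g * n))%g.
  by move=> Nn; rewrite -!mulgA mulKg cC.
have [/memg[n Nn Dh]|hc] := boolP ((h * c^-1)%g \in cset G (coset N g)).
  by rewrite -[h in RHS](mulgKV c) Dh gnc // mulKg.
rewrite (gsa _ hc); apply/esym/gsa; apply: contra hc => gh.
have [n Nn Dh] := memg _ gh.
suff -> : (h * c^-1)%g = ((g * c * g^-1)^-1 * h)%g by [].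
by rewrite Dh -[h](mulKVg (g * c * g^-1)%g) Dh -gnc // mulgK.
Qed.

Lemma ind_delta_graded_overP : ind_delta_graded_over delta_mod.
Proof.
exists ract; split; [exact: ract_spec | exact: ind_delta_graded | exact: ind_delta_over].
Qed.

End DeltaModule.

(** * The fibre product K *)

Section Fibre.
Variables (gT : finGroupType) (G N Q G' N' : {group gT}) (K : {group gT * gT}).
Hypotheses (nsNG : (N <| G)%g) (sG'G : G' \subset G) (sQG' : Q \subset G')
  (defN' : N' = G' :&: N :> {set gT})
  (defK : K = [set x in setX G G' | coset N x.1 == coset N x.2] :> {set gT * gT}).

Let nNG := subsetP (normal_norm nsNG).

Lemma mem_fibre g h :
  ((g, h) \in K) = [&& g \in G, h \in G' & coset N g == coset N h].
Proof. by rewrite defK !inE andbA. Qed.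

Lemma fibre_sub g h : (g, h) \in K -> (g * h^-1)%g \in N.
Proof.
rewrite mem_fibre => /and3P[Gg G'h /eqP gh]; have Gh := subsetP sG'G h G'h.
by rewrite -mem_rcoset; apply/rcoset_kercosetP; rewrite ?nNG.
Qed.

Lemma fibre_decomp (g h : gT) :
  (g, h) = (((g * h^-1)%g, 1%g) * (h, h))%g :> (gT * gT)%type.
Proof. by congr (_, _); rewrite ?mulgKV // mul1g. Qed.

Lemma diag_sub_fibre : diag G' \subset K.
Proof.
by apply/subsetP => _ /imsetP[g G'g ->]; rewrite mem_fibre G'g (subsetP sG'G) /=.
Qed.

Lemma fibre_mul_diag : K \subset (setX N N' * diag G')%g.
Proof.
apply/subsetP => -[g h] Kgh; rewrite fibre_decomp mem_mulg //.
  by rewrite inE /= fibre_sub //= group1.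
by apply/imsetP; exists h => //; move: Kgh; rewrite mem_fibre => /and3P[].
Qed.

Lemma setX_normal_fibre : (setX N N' <| K)%g.
Proof.
rewrite /normal (setX_sub_fibre nsNG defN' defK).
apply/subsetP => -[g h] Kgh; rewrite inE; apply/subsetP => _ /imsetP[[n n'] nn' ->].
move: nn' Kgh; rewrite defN' !inE /= mem_fibre.
case/andP=> Nn /andP[G'n' Nn'] /and3P[Gg G'h _].
have Gh := subsetP sG'G h G'h.
by rewrite -!conjgE (groupJ G'n' G'h) !(memJ_norm, nNG) // Nn.
Qed.

Lemma diag_sub (A B : {set gT}) : A \subset B -> diag A \subset diag B.
Proof. exact: imsetS. Qed.

Lemma card_diag (A : {set gT}) : #|diag A| = #|A|.
Proof. by apply: card_imset => x y []. Qed.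

(** By the second isomorphism theorem K / L is the quotient of Delta G' by its intersection with L =
    N x N'. *)
Lemma fibre_indexes : diag Q \subset setX N N' ->
  (#|(K / setX N N')%g| * #|diag G' :&: setX N N' : diag Q|%g)%N = #|G' : Q|%g.
Proof.
move=> sQL.
have nsLK := setX_normal_fibre; have sHK := diag_sub_fibre.
have sQH := diag_sub sQG'.
have -> : #|G' : Q|%g = #|diag_group G' : diag_group Q|%g.
  by rewrite -!divgS // !card_diag.
have DK : K = (setX_group N N' * diag_group G')%g :> {set _}.
  apply/eqP; rewrite eqEsubset fibre_mul_diag mulG_subG.
  by rewrite (normal_sub nsLK) sHK.
have -> : (K / setX N N' = diag_group G' / setX_group N N')%g.
  by rewrite DK quotientMidl.
have nLH := subset_trans sHK (normal_norm nsLK).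
rewrite (card_isog (isog_symr (second_isog nLH))) setIC card_quotient; last first.
  by rewrite normsI ?normG.
by rewrite Lagrange_index ?subsetIl // subsetI sQH.
Qed.
End Fibre.

(** * Transport of structure, and the final assembly *)

Section Transport.
Variables (O : comNzRingType) (R : algType O) (E : subalg R).
Variables (S : module E) (M : lmodType O) (f : M -> S) (mu : S -> M).
Hypotheses (muD : forall s t, mu (s + t) = mu s + mu t)
  (muZ : forall (c : O) s, mu (c *: s) = c *: mu s)
  (fK : cancel f mu) (muK : cancel mu f).

(** Moves the action of [S] to a given carrier, since the bimodule has to be built on [M] itself. *)
Fact transport_axioms : mod_axioms E (fun a m => mu (mod_act a (f m))).
Proof.
have [D Z Dl Zl A U] := mod_actP S.
have fD m n : f (m + n) = f m + f n by apply: (can_inj muK); rewrite muD !fK.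
have fZ (c : O) m : f (c *: m) = c *: f m by apply: (can_inj muK); rewrite muZ !fK.
split=> [a Ea v w|a Ea c v|a d Ea Ed v|c a Ea v|a d Ea Ed v|v].
- by rewrite fD D.
- by rewrite fZ Z.
- by rewrite Dl.
- by rewrite Zl.
- by rewrite muK A.
- by rewrite U.
Qed.

Definition transport : module E := Module transport_axioms.
End Transport.

Theorem proposition4p2
  (p : nat) (O : idomainType) (k : closedFieldType) (red : {rmorphism O -> k})
  (gT : finGroupType) (G N Q G' N' : {group gT}) (K : {group gT * gT})
  (b b' : galg O gT)
  (pmodO : modular_system p red #|G|)
  (nsNG : (N <| G)%g)
  (sylQ : (p.-Sylow(G) Q)%g)
  (defG' : G' = 'N_G(Q)%g :> {set gT})
  (defN' : N' = G' :&: N :> {set gT})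
  (blk_b : principal_block N b)
  (blk_b' : principal_block N' b')
  (defK : K = [set x in setX G G' | coset N x.1 == coset N x.2]
            :> {set gT * gT})
  (p'Gbar : ~~ (p %| #|(G / N)%g|)%N)
  (M : module (galgO O (setX N N'))) (scM : is_scott (diag_group Q) M)
  (S : module (galgO O K)) (scS : is_scott (diag_group Q) S) :
  let resS := res (setX_sub_fibre nsNG defN' defK) S in
  isomorphic M resS /\
  exists f : M -> resS, mod_iso f /\
  exists (act : galg O (gT * opgroup gT)%type -> M -> M)
         (actP : mod_axioms (delta_alg b b' G G' N) act),
    (forall g g' m, (g, g') \in K ->
       f (act (tens (b * gelt O g) (b' * gelt O g'^-1%g)) m)
         = mod_act (gelt O (g, g')) (f m : S))
    /\ ind_delta_graded_over (Module actP).
Proof.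
move=> resS.
have [Ocomplete [red_surj red0P] pk _] := pmodO.
have [sQL [M_ind _ [fM [fMh fM_surj]]]] := scM.
have sQG : Q \subset G := pHall_sub sylQ.
have sG'G : G' \subset G by rewrite defG' subsetIl.
have sQG' : Q \subset G' by rewrite defG' subsetI sQG normG.
(* The inclusion of [diag Q] in [setX N N'] is part of [is_scott]. It puts [Q] inside [N], hence
   ['C_G(N)] inside ['N_G(Q)]. *)
have sQN : Q \subset N.
  apply/subsetP => q Qq; have /(subsetP sQL) : (q, q) \in diag Q by apply: imset_f.
  by rewrite inE => /andP[].
have sCG' : 'C_G(N)%g \subset G'.
  by rewrite defG' setIS // (subset_trans (centS sQN)) // cent_sub.
have index_p' : ~~ (p %| #|G' : Q|%g)%N.
  have [_ _] := and3P sylQ; rewrite -(Lagrange_index sG'G sQG') => p'index.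
  have p_pr : prime p by case/andP: pk.
  by move: p'index; rewrite p'natE // Euclid_dvdM // negb_or => /andP[].
have index_eq := fibre_indexes nsNG sG'G sQG' defN' defK sQL.
have unit_p' n : (n %| #|G' : Q|%g)%N -> n%:R \is a (@GRing.unit O).
  move=> n_dv; rewrite (unit_red red0P) rmorph_nat -(dvdn_pcharf pk).
  by apply: contra index_p' => p_n; apply: dvdn_trans p_n n_dv.
have nsLK := setX_normal_fibre nsNG sG'G defN' defK.
have sHK := diag_sub_fibre sG'G defK.
have [|||[mu [muh mu_bij]] [j [q [jh qh jK]]]] :=
    scott_res Ocomplete red_surj red0P nsLK (setX_sub_fibre nsNG defN' defK)
      (diag_sub sQG') sHK sQL (fibre_mul_diag N' nsNG sG'G defK) _ _ _ scM scS.
- by apply: unit_p'; rewrite -index_eq dvdn_mulr.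
- by apply: unit_p'; rewrite -!divgS ?diag_sub // !card_diag.
- by apply: unit_p'; rewrite -index_eq dvdn_mull.
have [f [fh muK fK]] := mod_hom_inv muh mu_bij.
have fiso : mod_iso f by split=> //; exists mu.
split; first by exists f.
exists f; split=> //; have [muD muZ _] := muh; have [_ _ fa] := fh.
(* [D] is [M] with the action of [K] carried over from [S]; since [f] is linear over O(N x N'), it
   extends the action already present on [M]. *)
pose D : module (galgO O K) := @transport _ _ _ S M f mu muD muZ fK muK.
have fM0 : exists m, fM m != 0.
  by have [m fm] := fM_surj 1; exists m; rewrite fm oner_neq0.
have [[[bN _ bb] _ _] b1] := blk_b; have [[[b'N' _ b'b'] _ _] b'1] := blk_b'.
have D_act z (m : D) : supported (setX N N') z -> mod_act z m = mod_act z (m : M).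
  by move=> Lz; rewrite /= -[RHS]fK; congr mu; apply: esym (fa z Lz m).
have supp1 (H : {group gT}) : supported H (1 : galg O gT) by apply: supported1.
have act_b (d : D) : mod_act (untwist (tens b 1)) d = d.
  have Lb : supported (setX N N') (untwist (tens b 1)).
    apply: (untwist_supported bN (supp1 N')) => g h Ng N'h.
    by rewrite inE /= Ng -groupV.
  rewrite D_act //; apply: (central_act M_ind fMh fM0 Lb) => [[g h]||].
  - rewrite inE => /andP[/= Ng _]; rewrite -untwist_gelt -!untwistM !tensM mulr1 mul1r.
    by rewrite (principal_block_central blk_b).
  - by rewrite -untwistM tensM bb mulr1.
  - by rewrite aug_untwist aug1 mulr1.
have act_b' (d : D) : mod_act (untwist (tens 1 b')) d = d.
  have Lb : supported (setX N N') (untwist (tens 1 b')).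
    apply: (untwist_supported (supp1 N) b'N') => g h Ng N'h.
    by rewrite inE /= Ng -groupV.
  rewrite D_act //; apply: (central_act M_ind fMh fM0 Lb) => [[g h]||].
  - rewrite inE => /andP[/= _ N'h]; rewrite -untwist_gelt -!untwistM !tensM mulr1 mul1r.
    by rewrite (principal_block_central blk_b') // groupV.
  - by rewrite -untwistM tensM b'b' mulr1.
  - by rewrite aug_untwist aug1 mul1r.
have bG := principal_block_stable nsNG blk_b.
have b'N : supported (G' :&: N) b' by rewrite -defN'.
have T_C c (t : ind_triv O sHK) : c \in 'C_G(N)%g -> mod_act (gelt O (c, c)) t = t.
  move=> Cc; have Kc : (c, c) \in K.
    by apply: (subsetP sHK); apply/imsetP; exists c => //; apply: (subsetP sCG').
  have [TD TZ _ _ _ _] := mod_actP (ind_triv O sHK); have sc := supported_gelt O Kc.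
  move: t; apply: ind_ext => [s t|c' t|//|//|[g h] Kgh]; [exact: TD|exact: TZ|].
  have [_ G'h _] : [/\ g \in G, h \in G' & coset N g == coset N h].
    by apply/and3P; rewrite -(mem_fibre defK).
  have Hhh : (h, h) \in diag G' by apply/imsetP; exists h.
  have Khh := subsetP sHK _ Hhh.
  have Hcc : (c, c) \in diag G'.
    by apply/imsetP; exists c => //; apply: (subsetP sCG').
  have Ngh := fibre_sub nsNG sG'G defK Kgh.
  have Kx : ((g * h^-1)%g, 1%g) \in K.
    rewrite (mem_fibre defK) (subsetP (normal_sub nsNG)) // group1 /=.
    by rewrite coset_id // coset_id.
  (* [(c, c)] passes [(g h^-1, 1)] because [g h^-1] lies in [N], and then meets the base, which the
     diagonal elements fix. *)
  rewrite fibre_decomp mod_act_geltM // ind_base_fixed // -mod_act_geltM //.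
  have -> : ((c, c) * ((g * h^-1)%g, 1%g) = ((g * h^-1)%g, 1%g) * (c, c))%g.
    congr (_, _); last by rewrite mulg1 mul1g.
    by have /setIP[_ /centP cN] := Cc; apply: cN.
  by rewrite mod_act_geltM // ind_base_fixed.
(* The splitting [j], [q] passes this from the permutation module to [S], and [f] to [D]. *)
have act_C c (d : D) : c \in 'C_G(N)%g -> mod_act (gelt O (c, c)) d = d.
  move=> Cc; have Kc : (c, c) \in K.
    by apply: (subsetP sHK); apply/imsetP; exists c => //; apply: (subsetP sCG').
  have [_ _ qa] := qh.
  have sc := supported_gelt O Kc; rewrite /= -[f d]jK.
  have [_ _ ja] := jh.
  by rewrite -qa // T_C // jK fK.
exists (delta_act (D := D)), (delta_axioms nsNG sG'G defK bN bb b'N act_b act_b'); split.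
  move=> g h m Kgh; have supp_b := supp_l nsNG sG'G defK bN.
  have supp_b' := supp_1b' nsNG sG'G defK b'N; have supp_gh := supp_gelt O Kgh.
  rewrite -[RHS]muK; congr f.
  transitivity (mod_act (gelt O (g, h)) (m : D)); last by [].
  rewrite /delta_act (_ : tens _ _ = tens b 1 * (tens (gelt O g) (gelt O h^-1) * tens 1 b')).
    rewrite actM_sup //; last by rewrite untwistM; apply: supportedM.
    by rewrite act_b actM_sup // act_b' act_gelt.
  by rewrite !tensM !mulr1.
exact (ind_delta_graded_overP nsNG sG'G defK bN bb bG b'N act_b act_b' sCG' act_C).
Qed.
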